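(* For every integer $d\ge 1$ there exist constants $B,C>0$, depending only on $d$, such that for all $N\in\mathbb{N}$ large enough and for all $t\ge 0$, $$\mathbb{E}\Bigl[\Bigl\|\frac{\eta_t(0,\cdot)}{\pi}-1\Bigr\|_2^2\Bigr]\;\le\;\frac{C N^d}{\bigl(N^d\wedge t^{d/2}\bigr)\vee 1}\,\exp\Bigl(-\frac{2t}{t_{\rm rel}}+\frac{Bt}{N^{d+2}}\Bigr),$$ where $\eta_t(0,\cdot)$ is the averaging process on $\mathbb{T}^d_N$ started from the unit mass at $0$, $\pi$ is the uniform distribution on $\mathbb{T}^d_N$, and $t_{\rm rel}=1/(1-\cos(2\pi/N))$.
   Context: $\mathbb{T}^d_N=(\mathbb{Z}/N\mathbb{Z})^d$ is the discrete torus with graph distance $|x-y|$ (nearest neighbors are pairs with $|x-y|=1$); $\pi\equiv N^{-d}$ is the uniform distribution on it; $\mathcal{P}(\mathbb{T}^d_N)$ is the set of probability mass functions on $\mathbb{T}^d_N$; $\|\psi\|_2=\bigl(\sum_{x}\pi(x)|\psi(x)|^2\bigr)^{1/2}$ is the $L^2$-norm on $(\mathbb{T}^d_N,\pi)$. Averaging process: the Markov jump process on $\mathcal{P}(\mathbb{T}^d_N)$ with generator $\mathcal{L}f(\eta)=\frac12\sum_{x\in\mathbb{T}^d_N}\sum_{y:|x-y|=1}\bigl(f(\eta^{xy})-f(\eta)\bigr)$ for continuous $f$, where $\eta^{xy}(z)=\frac12(\eta(x)+\eta(y))$ if $z\in\{x,y\}$ and $\eta^{xy}(z)=\eta(z)$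 otherwise. That is, each unordered nearest-neighbor pair has an independent rate-1 Poisson clock, and when it rings the two masses are replaced by their average. $\mathbb{P},\mathbb{E}$ are the law and expectation of the random updates. $\eta_t(0,\cdot)$ denotes the process at time $t$ started from the Dirac mass $\mathbf{1}_0$ at $0\in\mathbb{T}^d_N$. $t_{\rm rel}=1/\lambda$ is the relaxation time of the random walk with generator $L^{\rm RW}\psi(x)=\frac12\sum_{y:|x-y|=1}(\psi(y)-\psi(x))$, where $\lambda=1-\cos(2\pi/N)$ is its spectral gap. Notation: $a\wedge b=\min\{a,b\}$, $a\vee b=\max\{a,b\}$. *)

(* Defs.v *)
From HB Require Import structures.
From mathcomp Require Export all_boot all_order all_algebra.
From mathcomp Require Export all_classical all_reals all_analysis.
Export numFieldNormedType.Exports.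

Set Implicit Arguments.
Unset Strict Implicit.
Unset Printing Implicit Defensive.

Import Order.TTheory GRing.Theory Num.Theory.
Local Open Scope classical_set_scope.
Local Open Scope ring_scope.

Section markov_processes.
Context {R : realType} {K : topologicalType}.

(* Feller semigroup on C(K); K is meant to be compact. Only the times [0 <= t]
   and the continuous functions matter, everything else is junk. *)
Record markov_semigroup (S : R -> (K -> R) -> K -> R) : Prop := {
  semigroup_continuous : forall (t : R) (f : K -> R),
    0 <= t -> continuous f -> continuous (S t f);
  semigroup_linear : forall (t a : R) (f g : K -> R),
    0 <= t -> continuous f -> continuous g ->
    forall x, S t (fun y => a * f y + g y) x = a * S t f x + S t g x;
  semigroup_ge0 : forall (t : R) (f : K -> R),
    0 <= t -> continuous f -> (forall x, 0 <= f x) -> forall x, 0 <= S t f x;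
  semigroup_cst1 : forall t : R, 0 <= t -> forall x, S t (fun=> 1) x = 1;
  semigroup_0 : forall f : K -> R, continuous f -> forall x, S 0 f x = f x;
  semigroup_add : forall (s t : R) (f : K -> R),
    0 <= s -> 0 <= t -> continuous f ->
    forall x, S (s + t) f x = S s (S t f) x;
  semigroup_strong : forall f : K -> R, continuous f ->
    {uniform, S t f @[t --> 0^'+] --> f} }.

(* The generator of S is L, with domain the whole of C(K) (so L is bounded). *)
Definition has_generator (S : R -> (K -> R) -> K -> R)
    (L : (K -> R) -> K -> R) : Prop :=
  forall f : K -> R, continuous f ->
    {uniform, (fun x => t^-1 * (S t f x - f x)) @[t --> 0^'+] --> L f}.

Context {dO : measure_display} {Omega : measurableType dO}.

Definition history (X : R -> Omega -> K) (t : R) : set_system Omega :=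
  <<s [set A | exists s U, [/\ 0 <= s <= t, open U & A = X s @^-1` U]] >>.

(* Conditionally on the history up to time s, X (s + t) has law S t _ (X s). *)
Definition markov_property (P : probability Omega R)
    (S : R -> (K -> R) -> K -> R) (X : R -> Omega -> K) : Prop :=
  forall (s t : R) (f : K -> R) (A : set Omega),
    0 <= s -> 0 <= t -> continuous f -> history X s A ->
    (\int[P]_(w in A) (f (X (s + t) w))%:E =
     \int[P]_(w in A) (S t f (X s w))%:E)%E.

(* In each bounded time interval there are finitely many jump times, listed in
   js, and the path is constant on [u, v[ for consecutive jump times u < v;
   in particular it is right-continuous. *)
Definition jump_path (p : R -> K) : Prop :=
  forall T : R, exists js : seq R, forall a b : R, 0 <= a -> a <= b -> b <= T ->
    (forall u, u \in js -> ~~ (a < u <= b)) -> p a = p b.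

Record markov_jump_process (P : probability Omega R)
    (L : (K -> R) -> K -> R) (x0 : K) (X : R -> Omega -> K) : Prop := {
  process_measurable : forall (t : R) (U : set K),
    0 <= t -> open U -> measurable (X t @^-1` U);
  process_path : {ae P, forall w, jump_path (X ^~ w)};
  process_start : {ae P, forall w, X 0 w = x0};
  process_markov : exists S : R -> (K -> R) -> K -> R,
    [/\ markov_semigroup S, has_generator S L & markov_property P S X] }.

End markov_processes.

Section mass_functions.
Context {R : realType} {T : finType}.

Definition simplex : set {ptws T -> R} :=
  [set p | (forall x, 0 <= p x) /\ \sum_(x : T) p x = 1].

Definition mass (p : simplex) (x : T) : R := set_val p x.

Definition average_fun (p : {ptws T -> R}) (x y : T) : {ptws T -> R} :=
  fun z => if (z == x) || (z == y) then (p x + p y) / 2 else p z.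

Lemma average_subproof (p : simplex) (x y : T) :
  average_fun (set_val p) x y \in simplex.
Proof.
have [p0 p1] := set_mem (valP p); rewrite inE; split=> [z|].
  rewrite /average_fun; case: ifP => _; last exact: p0.
  by rewrite divr_ge0 ?addr_ge0 ?p0.
rewrite -[RHS]p1 /average_fun; have [<-|xy] := eqVneq x y.
  apply: eq_bigr => z _; rewrite orbb; case: eqP => // ->.
  by rewrite mulrDl -splitr.
rewrite (bigD1 x) //= [RHS](bigD1 x) //= (bigD1 y) 1?eq_sym //=.
rewrite [in RHS](bigD1 y) 1?eq_sym //= !eqxx orbT /= !addrA -splitr.
by congr (_ + _); apply: eq_bigr => z /andP[/negPf -> /negPf ->].
Qed.

Definition average (p : simplex) (x y : T) : simplex :=
  exist (fun q => q \in simplex) _ (average_subproof p x y).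

Lemma dirac_subproof (x : T) :
  ((fun z => (z == x)%:R) : {ptws T -> R}) \in simplex.
Proof.
rewrite inE; split=> [z|]; first exact: ler0n.
by rewrite (bigD1 x) //= eqxx big1 ?addr0 // => z /negPf ->.
Qed.

Definition dirac_mass (x : T) : simplex := exist (fun q => q \in simplex) _ (dirac_subproof x).

Definition l2norm (pi psi : T -> R) : R :=
  Num.sqrt (\sum_(x : T) pi x * `|psi x| ^+ 2).

End mass_functions.

Notation pmf R T := (set_type (@simplex R T)).

(* ['Z_N] is Z/NZ only for N >= 2. *)
Notation torus d N := 'rV['Z_N]_d.

(* The graph distance of the torus is the l^1 sum of the cyclic distances of
   the coordinates. *)
Definition torus_dist (d N : nat) (x y : torus d N) : nat :=
  (\sum_(i < d) minn ((x - y)%R ord0 i) (N - (x - y)%R ord0 i))%N.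

Definition uniform_mass {R : realType} (d N : nat) (x : torus d N) : R :=
  (N%:R ^+ d)^-1.

Definition averaging_generator {R : realType} (d N : nat)
    (f : pmf R (torus d N) -> R) (eta : pmf R (torus d N)) : R :=
  2^-1 * \sum_(x : torus d N) \sum_(y : torus d N | torus_dist x y == 1%N)
           (f (average eta x y) - f eta).

Definition averaging_process {R : realType} (d N : nat)
    (dO : measure_display) (Omega : measurableType dO)
    (P : probability Omega R) (eta0 : pmf R (torus d N))
    (eta : R -> Omega -> pmf R (torus d N)) : Prop :=
  markov_jump_process P (@averaging_generator R d N) eta0 eta.

Definition relaxation_time {R : realType} (N : nat) : R :=
  1 / (1 - cos (2 * pi / N%:R)).

(* Main.v *)
Require Import Defs.
From mathcomp Require Import lra ring zify measurable_realfun.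
Import Order.TTheory GRing.Theory Num.Theory.
Local Open Scope classical_set_scope.
Local Open Scope ring_scope.

(* The autocorrelation z |-> sum_x eta(x) eta(x + z) of the averaging
   process has a closed evolution: its expectation u_t solves the heat equation
   of the walk on the torus which jumps at rate 1 along each edge, except along
   the edges at 0, which are slowed down to rate 1/2. The quantity to bound is
   N^d u_t(0) - 1, and u_{2t}(0) = sum_z u_t(z)^2 because the generator is
   symmetric and u_0 is the unit mass at 0. The slowed Dirichlet form is at
   least half of the usual one, so that Nash's inequality gives |u_t -
   N^{-d}|_2^2 <= K t^{-d/2}. Its spectral gap is at least 2 (1 - cos (2 pi /
   N)) - B N^{-d-2}: slowing down the edges at 0 costs at most a fixed fraction
   of the energy of the high frequencies, and O(N^{-d-2}) for the boundedly
   many low ones. Running Nash's bound up to time min(t, N^2) and the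
   exponential decay afterwards gives the estimate. Both functional
   inequalities are read off the discrete Hartley transform. *)

(** * Real analysis *)

Section real_analysis.
Context {R : realType}.

(** The mean value theorem. The derivative is asked for on the open interval only, because the heat
    flow below is known to be differentiable only at positive times. *)
Lemma derive_le0_nincr (f df : R -> R) (a b : R) : a <= b ->
  (forall x, a < x < b -> is_derive x 1 f (df x)) ->
  (forall x, a < x < b -> df x <= 0) ->
  {within `[a, b], continuous f} -> f b <= f a.
Proof.
rewrite le_eqVlt => /predU1P[->//|ab] fdf df0 cf.
have {}fdf x : x \in `]a, b[ -> is_derive x 1 f (df x).
  by rewrite in_itv; exact: fdf.
have [c cab E] := MVT ab fdf cf.
rewrite -subr_le0 E mulr_le0_ge0 ?subr_ge0 ?(ltW ab) //.
by apply: df0; move: cab; rewrite in_itv.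
Qed.

Lemma cos_nincr (x y : R) : 0 <= x -> x <= y -> y <= pi -> cos y <= cos x.
Proof.
move=> x0; rewrite le_eqVlt => /predU1P[->//|xy] ypi.
rewrite ltW // ltr_cos ?in_itv //= ?x0 ?ypi ?(le_trans x0 (ltW xy)) //.
by rewrite (le_trans (ltW xy)).
Qed.

Lemma sin_le_id (x : R) : 0 <= x -> sin x <= x.
Proof.
move=> x0.
have := @derive_le0_nincr (fun y => sin y - y) (fun y => cos y - 1) 0 x x0.
rewrite sin0 subrr subr_le0; apply.
- by move=> y _; rewrite subr_le0 cos_le1.
- apply: continuous_subspaceT => y.
  by apply: cvgB; [exact: continuous_sin|exact: cvg_id].
Qed.

(** Put [y = x / 2]. On [0, pi/4] the cosine is at least [c = cos (pi / 4)], hence [sin y >= c * y],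
    and [sin x = 2 * cos y * sin y >= 2 * c ^+ 2 * y = y]. *)
Lemma sin_ge_half (x : R) : 0 <= x <= pi / 2 -> x / 2 <= sin x.
Proof.
move=> /andP[x0 xpi]; have pi0 := pi_gt0 R.
pose c : R := cos (pi / 4).
have c0 : 0 <= c by apply: cos_ge0_pihalf; lra.
have c2 : c ^+ 2 = 2^-1.
  have := cos_pihalf R; rewrite (_ : pi / 2 = (pi / 4) *+ 2); last first.
    by rewrite -mulr_natr; field.
  rewrite cos_mulr2n -/c -mulr_natr; lra.
have cosc y : 0 <= y <= pi / 4 -> c <= cos y.
  by move=> ?; apply: cos_nincr; lra.
pose y := x / 2; have y01 : 0 <= y <= pi / 4 by rewrite /y; lra.
have sy : c * y <= sin y.
  case/andP: y01 => y0 y1.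
  have := @derive_le0_nincr (fun z => c * z - sin z) (fun z => c *: 1 - cos z) 0 y y0.
  rewrite mulr0 sin0 subrr subr_le0; apply.
  - move=> z /andP[z0 zy]; rewrite subr_le0 [_ *: _]mulr1; apply: cosc; lra.
  - apply: continuous_subspaceT => z.
    by apply: cvgB; [apply: cvgMr; exact: cvg_id|exact: continuous_sin].
have -> : x = y *+ 2 by rewrite /y -mulr_natr; field.
have {}cosc := cosc y y01.
suff : y <= (cos y * sin y) *+ 2.
  by rewrite -sin_mulr2n -[y *+ 2 in X in X / 2]mulr_natr mulfK ?pnatr_eq0.
rewrite -[X in _ <= X]mulr_natr.
have : c * (c * y) <= cos y * sin y.
  by apply: ler_pM => //; rewrite mulr_ge0 //; lra.
by rewrite mulrA -expr2 c2; lra.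
Qed.

Lemma one_subcosE (x : R) : 1 - cos x = 2 * sin (x / 2) ^+ 2.
Proof.
have {1}-> : x = (x / 2) *+ 2 by rewrite -mulr_natr; field.
by rewrite cos_mulr2n sin2cos2 -mulr_natr; ring.
Qed.

Lemma one_subcos_le (x : R) : 0 <= x <= pi -> 1 - cos x <= x ^+ 2 / 2.
Proof.
move=> x0; rewrite one_subcosE.
have s0 : 0 <= sin (x / 2) by apply: sin_ge0_pi; lra.
have : sin (x / 2) <= x / 2 by apply: sin_le_id; lra.
nra.
Qed.

Lemma one_subcos_ge (x : R) : 0 <= x <= pi -> x ^+ 2 / 8 <= 1 - cos x.
Proof.
move=> x0; rewrite one_subcosE.
have : x / 2 / 2 <= sin (x / 2) by apply: sin_ge_half; lra.
nra.
Qed.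

End real_analysis.

(** * Derivatives and continuity of finite sums and products *)

Section calculus.
Context {R : realType}.
Implicit Types f g : R -> R.

Lemma is_derive_sum_seq (I : Type) (r : seq I) (F : I -> R -> R) (dF : I -> R) (t : R) :
  (forall i, is_derive t 1 (F i) (dF i)) ->
  is_derive t 1 (fun s => \sum_(i <- r) F i s) (\sum_(i <- r) dF i).
Proof.
move=> h; elim: r => [|i r IH].
  rewrite big_nil (_ : (fun _ => _) = cst 0); first exact: is_derive_cst.
  by apply/funext => s; rewrite big_nil.
rewrite big_cons (_ : (fun _ => _) = F i + (fun s => \sum_(j <- r) F j s)).
  exact: is_deriveD.
by apply/funext => s; rewrite big_cons.
Qed.

Lemma is_derive_mul f g (t a b : R) : is_derive t 1 f a -> is_derive t 1 g b ->
  is_derive t 1 (fun s => f s * g s) (f t * b + a * g t).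
Proof. by move=> fa gb; apply: is_derive_eq (is_deriveM fa gb) _; rewrite [a * _]mulrC. Qed.

Lemma continuous_sum_seq (K : topologicalType) (I : Type) (r : seq I) (P : pred I)
    (F : I -> K -> R) :
  (forall i, continuous (F i)) -> continuous (fun s => \sum_(i <- r | P i) F i s).
Proof.
move=> h t; elim: r => [|i r IH].
  rewrite (_ : (fun _ => _) = cst 0); first exact: cst_continuous.
  by apply/funext => s; rewrite big_nil.
rewrite (_ : (fun _ => _) = (fun s => (if P i then F i s else 0) + \sum_(j <- r | P j) F j s)).
  by apply: cvgD => //; case: (P i); [exact: h|exact: cvg_cst].
by apply/funext => s; rewrite big_cons; case: (P i); rewrite ?add0r.
Qed.

Lemma continuous_add (K : topologicalType) (f g : K -> R) :
  continuous f -> continuous g -> continuous (fun x => f x + g x).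
Proof. by move=> cf cg x; apply: cvgD; [exact: cf|exact: cg]. Qed.

Lemma continuous_sub (K : topologicalType) (f g : K -> R) :
  continuous f -> continuous g -> continuous (fun x => f x - g x).
Proof. by move=> cf cg x; apply: cvgB; [exact: cf|exact: cg]. Qed.

Lemma continuous_mul (K : topologicalType) (f g : K -> R) :
  continuous f -> continuous g -> continuous (fun x => f x * g x).
Proof. by move=> cf cg x; apply: cvgM; [exact: cf|exact: cg]. Qed.

End calculus.

(** * Trigonometry on Z/NZ *)

Section zmod_trig.
Context {R : realType} {N : nat}.
Hypothesis N1 : (1 < N)%N.

Definition zangle (a : 'Z_N) : R := pi *+ 2 * (a : nat)%:R / N%:R.

Let N0 : N%:R != 0 :> R. Proof. by rewrite pnatr_eq0; case: N N1. Qed.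

(** The representative of [a + b] is a remainder modulo [N]; the quotient counts the full turns. *)
Lemma zangleD (a b : 'Z_N) :
  exists n, zangle a + zangle b = zangle (a + b) + pi *+ 2 *+ n.
Proof.
exists ((a + b) %/ N)%N; rewrite /zangle -mulrDl -mulrDr -natrD.
rewrite /= [in X in (_ %% X)%N]Zp_cast // {1}(divn_eq (a + b) N) natrD natrM.
by rewrite -[pi *+ 2 *+ _]mulr_natr; field.
Qed.

Lemma cos_zangleD (a b : 'Z_N) : cos (zangle (a + b)) =
  cos (zangle a) * cos (zangle b) - sin (zangle a) * sin (zangle b).
Proof.
by rewrite -cosD; have [n ->] := zangleD a b; rewrite (periodicn (@cosD2pi R)).
Qed.

Lemma sin_zangleD (a b : 'Z_N) : sin (zangle (a + b)) =
  sin (zangle a) * cos (zangle b) + cos (zangle a) * sin (zangle b).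
Proof.
by rewrite -sinD; have [n ->] := zangleD a b; rewrite (periodicn (@sinD2pi R)).
Qed.

Lemma zangle0 : zangle 0 = 0.
Proof. by rewrite /zangle mulr0 mul0r. Qed.

(** The addition formulas for [a + (- a) = 0] are a linear system in the cosine and sine of [- a],
    with determinant 1. The next lemma solves it for the sine. *)
Lemma cos_zangleN (a : 'Z_N) : cos (zangle (- a)) = cos (zangle a).
Proof.
have := cos_zangleD a (- a); have := sin_zangleD a (- a).
rewrite subrr zangle0 cos0 sin0.
have := cos2Dsin2 (zangle a).
set ca := cos (zangle a); set sa := sin (zangle a).
set c := cos (zangle (- a)); set s := sin (zangle (- a)) => h1 h2 h3.
transitivity (c * (ca ^+ 2 + sa ^+ 2)); first by rewrite h1 mulr1.
transitivity (ca * (ca * c - sa * s) + sa * (sa * c + ca * s)); first by ring.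
by rewrite -h2 -h3; ring.
Qed.

Lemma sin_zangleN (a : 'Z_N) : sin (zangle (- a)) = - sin (zangle a).
Proof.
have := cos_zangleD a (- a); have := sin_zangleD a (- a).
rewrite subrr zangle0 cos0 sin0.
have := cos2Dsin2 (zangle a).
set ca := cos (zangle a); set sa := sin (zangle a).
set c := cos (zangle (- a)); set s := sin (zangle (- a)) => h1 h2 h3.
transitivity (s * (ca ^+ 2 + sa ^+ 2)); first by rewrite h1 mulr1.
transitivity (ca * (sa * c + ca * s) - sa * (ca * c - sa * s)); first by ring.
by rewrite -h2 -h3; ring.
Qed.

(** Folds the angle into [0, pi], where the cosine is monotone and the quadratic bounds hold. *)
Lemma zangle_min (a : 'Z_N) (m := minn a (N - a)) :
  cos (zangle a) = cos (pi *+ 2 * m%:R / N%:R) /\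
  0 <= (pi *+ 2 * m%:R / N%:R : R) <= pi.
Proof.
have aN : (a < N)%N by rewrite -[X in (_ < X)%N](Zp_cast N1) ltn_ord.
have Npos : 0 < N%:R :> R by rewrite ltr0n; case: N N1.
have pi0 := pi_gt0 R.
split; rewrite /m /zangle; last first.
  have pi2 : 0 <= pi *+ 2 :> R by rewrite mulrn_wge0 // ltW.
  apply/andP; split; first by rewrite divr_ge0 // mulr_ge0.
  rewrite ler_pdivrMr // -[pi *+ 2]mulr_natr -mulrA ler_pM2l // -natrM ler_nat.
  by rewrite /minn; case: ltnP => ?; lia.
rewrite /minn; case: (ltnP a (N - a)%N) => // _.
rewrite natrB ?(ltnW aN) // mulrBr mulrBl mulfK // -[RHS]cosN opprB.
by rewrite -[in RHS](cosD2pi) subrK.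
Qed.

(** The folded angle is [2 * pi * q] with [q = m / N]; its square over 8 is [pi ^+ 2 * q ^+ 2 / 2],
    and [pi >= 2]. *)
Lemma one_subcos_zangle_ge (a : 'Z_N) :
  2 * ((minn a (N - a))%:R / N%:R) ^+ 2 <= 1 - cos (zangle a).
Proof.
have [-> h] := zangle_min a; apply: le_trans (one_subcos_ge _ h).
rewrite -mulrA -[pi *+ 2]mulr_natl; move: (_ / N%:R) => q; rewrite !exprMn.
have p4 : 4 <= pi ^+ 2 :> R by have := pi_ge2 R; nra.
have : 4 * q ^+ 2 <= pi ^+ 2 * q ^+ 2 by rewrite ler_wpM2r ?sqr_ge0.
lra.
Qed.

(** A nonzero residue folds to an angle of at least [2 * pi / N]. *)
Lemma one_subcos_zangle_gap (a : 'Z_N) : a != 0 ->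
  1 - cos (2 * pi / N%:R) <= 1 - cos (zangle a).
Proof.
move=> a0; have aN : (a < N)%N by rewrite -[X in (_ < X)%N](Zp_cast N1) ltn_ord.
have Npos : 0 < N%:R :> R by rewrite ltr0n; case: N N1.
have pi0 := pi_gt0 R.
have [-> /andP[h0 h1]] := zangle_min a; rewrite lerB // cos_nincr //.
  by rewrite divr_ge0 ?mulr_ge0 ?(ltW pi0).
rewrite -[pi *+ 2]mulr_natl ler_pM2r ?invr_gt0 // ler_peMr ?mulr_ge0 ?(ltW pi0) //.
rewrite ler1n leq_min subn_gt0 aN andbT lt0n.
by apply: contra a0 => /eqP a0; apply/eqP/val_inj.
Qed.

End zmod_trig.

(** * The slowed walk *)

Section slowed_walk.
Context {R : realType} {T : finZmodType} {E : {pred T}}.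
Hypotheses (EN : forall v, E (- v) = E v) (E0 : ~~ E 0).
Implicit Types f g : T -> R.

Definition inner f g : R := \sum_x f x * g x.

Definition laplacian f (x : T) : R := \sum_(v | E v) (f (x + v) - f x).

(* The walk jumping at rate 1 along the edges, except the edges at 0 which are
   slowed down to rate 1/2. *)
Definition slowed_laplacian f (x : T) : R :=
  laplacian f x + 2^-1 * \sum_(v | E v) (f 0 - f v) * ((x == 0)%:R - (x == v)%:R).

Definition dirichlet f : R := 2^-1 * \sum_x \sum_(v | E v) (f (x + v) - f x) ^+ 2.

(** The energy removed by the slowdown. The factor 1/2 is the lost rate, each edge at 0 being listed
    once; in [dirichlet] it compensates for counting each edge from both ends. *)
Definition dirichlet_at0 f : R := 2^-1 * \sum_(v | E v) (f 0 - f v) ^+ 2.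

Lemma sum_shift (v : T) (F : T -> R) : \sum_x F (x + v) = \sum_x F x.
Proof. by rewrite [RHS](reindex_inj (addIr v)). Qed.

Lemma sum_nbrN (F : T -> R) : \sum_(v | E v) F (- v) = \sum_(v | E v) F v.
Proof. by rewrite [RHS](reindex_inj oppr_inj); apply: eq_bigl => v; rewrite EN. Qed.

Lemma innerC f g : inner f g = inner g f.
Proof. by apply: eq_bigr => x _; rewrite mulrC. Qed.

(** Summation by parts: replacing [v] by [- v] and translating [x] by [v] turns half of the
    symmetrised sum into the other half. *)
Lemma inner_laplacianE f g : inner f (laplacian g) =
  - (2^-1 * \sum_x \sum_(v | E v) (f (x + v) - f x) * (g (x + v) - g x)).
Proof.
have -> : inner f (laplacian g) =
    \sum_(v | E v) \sum_x f x * (g (x + v) - g x).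
  by rewrite exchange_big; apply: eq_bigr => x _; rewrite mulr_sumr.
rewrite [in RHS]exchange_big /=.
set A := LHS; have -> : \sum_(v | E v) \sum_x
    (f (x + v) - f x) * (g (x + v) - g x) = - A - A; last by lra.
rewrite -[X in _ = _ - X]sum_nbrN -sumrN -sumrB.
apply: eq_bigr => v _; rewrite -sumrN.
rewrite -(sum_shift v (fun x => f x * (g (x - v) - g x))) -sumrB.
by apply: eq_bigr => x _; rewrite addrK; ring.
Qed.

Lemma inner_laplacianC f g : inner f (laplacian g) = inner (laplacian f) g.
Proof.
rewrite [RHS]innerC !inner_laplacianE.
by congr (- (_ * _)); apply: eq_bigr => x _; apply: eq_bigr => v _; rewrite mulrC.
Qed.

Lemma inner_laplacian_id f : inner f (laplacian f) = - dirichlet f.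
Proof. exact: inner_laplacianE. Qed.

Lemma inner_slowed_laplacianE f g : inner f (slowed_laplacian g) =
  inner f (laplacian g) + 2^-1 * \sum_(v | E v) (f 0 - f v) * (g 0 - g v).
Proof.
rewrite /inner; under eq_bigr do rewrite mulrDr.
rewrite big_split /=; congr (_ + _).
under eq_bigr do rewrite mulrCA mulr_sumr.
rewrite -mulr_sumr exchange_big /=; congr (_ * _); apply: eq_bigr => v _.
have sumI (a : T) : \sum_x f x * (x == a)%:R = f a.
  rewrite (bigD1 a) //= eqxx mulr1 big1 ?addr0 // => x /negPf ->.
  by rewrite mulr0.
rewrite -(sumI 0) -(sumI v) -sumrB mulr_suml.
by apply: eq_bigr => x _; ring.
Qed.

Lemma inner_slowed_laplacianC f g :
  inner f (slowed_laplacian g) = inner (slowed_laplacian f) g.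
Proof.
rewrite [RHS]innerC !inner_slowed_laplacianE inner_laplacianC innerC.
by congr (_ + _ * _); apply: eq_bigr => v _; rewrite mulrC.
Qed.

Lemma inner_slowed_laplacian_id f :
  inner f (slowed_laplacian f) = - (dirichlet f - dirichlet_at0 f).
Proof.
rewrite inner_slowed_laplacianE inner_laplacian_id opprB addrC; congr (_ - _).
Qed.

(* Each edge at 0 is counted once from 0 and once from its other end. *)
Lemma dirichlet_at0_le f : dirichlet_at0 f <= dirichlet f / 2.
Proof.
rewrite /dirichlet exchange_big /= /dirichlet_at0 -mulrA ler_pM2l ?invr_gt0 //.
have -> : \sum_(v | E v) (f 0 - f v) ^+ 2 =
    (\sum_(v | E v) ((f v - f 0) ^+ 2 + (f 0 - f (- v)) ^+ 2)) / 2.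
  rewrite big_split /= (sum_nbrN (fun v => (f 0 - f v) ^+ 2)).
  under [X in (X + _) / 2]eq_bigr do rewrite -sqrrN opprB.
  by field.
rewrite ler_pM2r ?invr_gt0 //; apply: ler_sum => v Ev.
have v0 : - v != 0 by rewrite oppr_eq0; apply: contraTneq Ev => ->.
rewrite (bigD1 0) //= (bigD1 (- v)) //= add0r addNr addrA lerDl.
by apply: sumr_ge0 => x _; exact: sqr_ge0.
Qed.

End slowed_walk.

(** * The Hartley transform on the torus *)

Section hartley.
Context {R : realType} {d N : nat}.
Hypothesis N1 : (1 < N)%N.
Local Notation T := (torus d N).
Local Notation n := (N%:R ^+ d : R).
Implicit Types (f g : T -> R) (k l x v : T).

Definition dotz k x : 'Z_N := \sum_i k ord0 i * x ord0 i.

Lemma dotzC k x : dotz k x = dotz x k.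
Proof. by apply: eq_bigr => i _; rewrite mulrC. Qed.

Lemma dotzDr k x v : dotz k (x + v) = dotz k x + dotz k v.
Proof. by rewrite -big_split; apply: eq_bigr => i _; rewrite mxE mulrDr. Qed.

Lemma dotzNr k x : dotz k (- x) = - dotz k x.
Proof. by rewrite -sumrN; apply: eq_bigr => i _; rewrite mxE mulrN. Qed.

Lemma dotz_delta k (i : 'I_d) : dotz k (delta_mx ord0 i) = k ord0 i.
Proof.
rewrite /dotz (bigD1 i) //= mxE !eqxx mulr1 big1 ?addr0 // => j /negPf ji.
by rewrite mxE eqxx ji mulr0.
Qed.

Definition cosd k x : R := cos (zangle (dotz k x)).
Definition sind k x : R := sin (zangle (dotz k x)).

Lemma cosdDr k x v : cosd k (x + v) = cosd k x * cosd k v - sind k x * sind k v.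
Proof. by rewrite /cosd dotzDr cos_zangleD. Qed.

Lemma sindDr k x v : sind k (x + v) = sind k x * cosd k v + cosd k x * sind k v.
Proof. by rewrite /sind dotzDr sin_zangleD. Qed.

Lemma cosdNr k x : cosd k (- x) = cosd k x.
Proof. by rewrite /cosd dotzNr cos_zangleN. Qed.

Lemma sindNr k x : sind k (- x) = - sind k x.
Proof. by rewrite /sind dotzNr sin_zangleN. Qed.

Lemma cosdC k x : cosd k x = cosd x k. Proof. by rewrite /cosd dotzC. Qed.
Lemma sindC k x : sind k x = sind x k. Proof. by rewrite /sind dotzC. Qed.

(* The kernel cos + sin of the Hartley transform: a real, symmetric substitute
   for the characters of the torus. *)
Definition cas k x : R := cosd k x + sind k x.

Lemma casC k x : cas k x = cas x k.
Proof. by rewrite /cas cosdC sindC. Qed.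

Lemma cas0 x : cas 0 x = 1.
Proof.
rewrite /cas /cosd /sind /dotz big1 ?zangle0 ?cos0 ?sin0 ?addr0 // => i _.
by rewrite mxE mul0r.
Qed.

Lemma cas_sqr_le2 k x : cas k x ^+ 2 <= 2.
Proof.
have := cos2Dsin2 (zangle (dotz k x) : R); rewrite /cas /cosd /sind.
have := sqr_ge0 (cos (zangle (dotz k x)) - sin (zangle (dotz k x)) : R).
move: (cos _) (sin _) => c s; nra.
Qed.

Lemma card_torus : #|{: T}|%:R = n.
Proof. by rewrite card_mx card_ord Zp_cast // mul1n natrX. Qed.

Lemma sum_sind k : \sum_x sind k x = 0.
Proof.
have : \sum_x sind k x = - \sum_x sind k x; last by lra.
rewrite -sumrN [LHS](reindex_inj oppr_inj).
by apply: eq_bigr => x _; rewrite sindNr.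
Qed.

Lemma cos2pi_lt1 : (2 < N)%N -> cos (2 * pi / N%:R) < 1 :> R.
Proof.
move=> N2; have pi0 := pi_gt0 R.
have N0 : 0 < N%:R :> R by rewrite ltr0n; case: N N1.
have N2r : (2 : R) <= N%:R by rewrite ler_nat.
rewrite -[ltRHS](@cos0 R) ltr_cos ?in_itv /= ?lexx ?(ltW pi0) //.
  by rewrite divr_gt0 // mulr_gt0.
rewrite divr_ge0 ?mulr_ge0 ?(ltW pi0) ?(ltW N0) //= ler_pdivrMr //.
by rewrite mulrC ler_pM2l.
Qed.

(** Translating by a unit vector [e] along a nonzero coordinate of [k] multiplies the sum by
    [cosd k e], since the sines sum to zero. This factor is below 1, so the sum vanishes. *)
Lemma sum_cosd k : (2 < N)%N -> k != 0 -> \sum_x cosd k x = 0.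
Proof.
move=> N2 k0.
have [i ki] : exists i, k ord0 i != 0.
  apply/existsP; apply: contraNT k0; rewrite negb_exists => /forallP k0.
  by apply/eqP/rowP => i; rewrite mxE; apply/eqP; have := k0 i; rewrite negbK.
pose e : T := delta_mx ord0 i.
have ce : cosd k e < 1.
  rewrite /cosd dotz_delta; have := cos2pi_lt1 N2.
  have := @one_subcos_zangle_gap R N N1 _ ki; lra.
have : \sum_x cosd k x = \sum_x cosd k (x + e) by rewrite sum_shift.
under [in X in _ = X]eq_bigr do rewrite cosdDr.
rewrite sumrB -!mulr_suml sum_sind mul0r subr0 => h.
have : (\sum_x cosd k x) * (1 - cosd k e) = 0 by rewrite mulrBr mulr1 -h subrr.
by move/eqP; rewrite mulf_eq0 subr_eq0 (gt_eqF ce) orbF => /eqP.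
Qed.

(** The product of the two kernels is the cosine at frequency [k - l] plus the sine at [k + l], and
    the sines sum to zero. *)
Lemma cas_ortho k l : (2 < N)%N -> \sum_x cas k x * cas l x = n * (k == l)%:R.
Proof.
move=> N2.
have -> : \sum_x cas k x * cas l x = \sum_x (cosd (k - l) x + sind (k + l) x).
  apply: eq_bigr => x _.
  by rewrite ![_ (_ + _) x]cosdC ![_ (_ + _) x]sindC cosdDr sindDr cosdNr sindNr
             -![cosd x _]cosdC -![sind x _]sindC /cas; ring.
rewrite big_split /= sum_sind addr0.
have [->|kl] := eqVneq k l; last by rewrite sum_cosd ?mulr0 // subr_eq0.
rewrite subrr mulr1 -card_torus -sum1_card natr_sum.
apply: eq_bigr => x _; have := cas0 x; rewrite /cosd /dotz big1 ?zangle0 ?cos0 //.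
by move=> i _; rewrite mxE mul0r.
Qed.

Definition hartley f k : R := inner f (cas k).

Hypothesis N2 : (2 < N)%N.

Let n_gt0 : 0 < n. Proof. by rewrite exprn_gt0 // ltr0n; case: N N1. Qed.

(** The kernel is symmetric and orthogonal up to scaling, so the transform is an involution up to
    the factor [N ^ d]. *)
Lemma hartley_inv f x : f x = n^-1 * \sum_k hartley f k * cas k x.
Proof.
under eq_bigr do rewrite /hartley /inner mulr_suml.
rewrite exchange_big /=.
under eq_bigr => y _.
  under eq_bigr do rewrite -mulrA casC (casC _ x).
  rewrite -mulr_sumr cas_ortho //; over.
rewrite (bigD1 x) //= eqxx big1 ?addr0; last first.
  by move=> y /negPf ->; rewrite !mulr0.
by rewrite mulr1 mulrCA mulVf ?mulr1 // gt_eqF.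
Qed.

Lemma parseval f g : inner f g = n^-1 * \sum_k hartley f k * hartley g k.
Proof.
rewrite /inner; under eq_bigr do rewrite (hartley_inv f) -mulrA mulr_suml.
rewrite -mulr_sumr exchange_big /=; congr (_ * _); apply: eq_bigr => k _.
by rewrite /hartley /inner mulr_sumr; apply: eq_bigr => x _; ring.
Qed.

Definition lowpass (A : {pred T}) f x : R := n^-1 * \sum_(k | A k) hartley f k * cas k x.

Lemma hartley_lowpass (A : {pred T}) f k :
  hartley (lowpass A f) k = (A k)%:R * hartley f k.
Proof.
rewrite /hartley {1}/inner /lowpass.
under eq_bigr do rewrite -mulrA mulr_suml.
rewrite -mulr_sumr exchange_big /=.
under eq_bigr => l _.
  under eq_bigr do rewrite -mulrA.
  rewrite -mulr_sumr cas_ortho //; over.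
rewrite big_mkcond (bigD1 k) //= eqxx big1 ?addr0; last first.
  by move=> l /negPf ->; rewrite !mulr0 if_same.
case: (A k); rewrite ?mulr0 ?mul0r // mulr1 mul1r.
by rewrite mulrCA mulVf ?mulr1 // gt_eqF.
Qed.

Lemma hartleyB f g k : hartley (fun x => f x - g x) k = hartley f k - hartley g k.
Proof. by rewrite -sumrB; apply: eq_bigr => x _; rewrite mulrBl. Qed.

Section spectrum.
Context {E : {pred T}}.
Hypotheses (EN : forall v, E (- v) = E v) (E0 : ~~ E 0).

Definition symbol k : R := \sum_(v | E v) (1 - cosd k v).

Lemma symbol_ge0 k : 0 <= symbol k.
Proof. by apply: sumr_ge0 => v _; rewrite subr_ge0 cos_le1. Qed.

(** The sines cancel between [v] and [- v], which makes [cas k] an eigenvector. *)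
Lemma laplacian_cas k x : laplacian (E := E) (cas k) x = - (symbol k * cas k x).
Proof.
have : \sum_(v | E v) sind k v = 0.
  have : \sum_(v | E v) sind k v = - \sum_(v | E v) sind k v; last by lra.
  rewrite -{1}(sum_nbrN EN) -sumrN; apply: eq_bigr => v _; exact: sindNr.
move=> s0; rewrite /laplacian.
transitivity (\sum_(v | E v) (- ((1 - cosd k v) * cas k x) +
    sind k v * (cosd k x - sind k x))).
  by apply: eq_bigr => v _; rewrite /cas cosdDr sindDr; ring.
by rewrite big_split /= -mulr_suml s0 mul0r addr0 sumrN -mulr_suml.
Qed.

Lemma dirichletE f : dirichlet (E := E) f = n^-1 * \sum_k symbol k * hartley f k ^+ 2.
Proof.
have hl k : hartley (laplacian (E := E) f) k = - (symbol k * hartley f k).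
  rewrite /hartley -inner_laplacianC // /inner mulr_sumr -sumrN.
  by apply: eq_bigr => x _; rewrite laplacian_cas; ring.
rewrite -[LHS]opprK -inner_laplacian_id // parseval -mulrN -sumrN.
by congr (_ * _); apply: eq_bigr => k _; rewrite hl; ring.
Qed.

End spectrum.

End hartley.

(** * The spectrum of the torus *)

(** Lagrange's identity: the double sum of squares equals [2 * (A * B - C ^+ 2)]. *)
Lemma cauchy_schwarz_sum (R : realDomainType) (I : finType) (P : pred I) (a b : I -> R) :
  (\sum_(i | P i) a i * b i) ^+ 2 <=
  (\sum_(i | P i) a i ^+ 2) * (\sum_(i | P i) b i ^+ 2).
Proof.
have : 0 <= \sum_(i | P i) \sum_(j | P j) (a i * b j - a j * b i) ^+ 2.
  by apply: sumr_ge0 => i _; apply: sumr_ge0 => j _; exact: sqr_ge0.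
set A := \sum_(i | P i) a i ^+ 2; set B := \sum_(i | P i) b i ^+ 2.
set C := \sum_(i | P i) a i * b i.
have -> : \sum_(i | P i) \sum_(j | P j) (a i * b j - a j * b i) ^+ 2 =
    \sum_(i | P i) (a i ^+ 2 * B + b i ^+ 2 * A - 2 * (a i * b i) * C).
  apply: eq_bigr => i _; rewrite !mulr_sumr -big_split -sumrB.
  by apply: eq_bigr => j _ /=; ring.
rewrite sumrB big_split /= -!mulr_suml -mulr_sumr -/A -/B -/C; lra.
Qed.

Section torus_neighbours.
Context {d N : nat}.
Local Notation T := (torus d N).
Implicit Types k v : T.

Definition nbr : {pred T} := fun v => torus_dist v 0 == 1%N.

Lemma torus_distE (x y : T) : torus_dist x y = torus_dist (x - y) 0.
Proof. by rewrite /torus_dist subr0. Qed.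

Lemma nbr0 : ~~ nbr 0.
Proof. by rewrite /nbr /torus_dist subrr big1 // => i _; rewrite mxE min0n. Qed.

Lemma neq0_coord k : k != 0 -> exists i, k ord0 i != 0.
Proof.
move=> k0; apply/existsP; apply: contraNT k0; rewrite negb_exists => /forallP k0.
by apply/eqP/rowP => i; rewrite mxE; apply/eqP; have := k0 i; rewrite negbK.
Qed.

Lemma card_rows (P : {pred 'Z_N}) :
  (#|[pred k : T | [forall i, P (k ord0 i)]]| <= #|P| ^ d)%N.
Proof.
pose F k := [ffun i : 'I_d => k ord0 i].
have Finj : injective F.
  by move=> k l /ffunP kl; apply/rowP => i; have := kl i; rewrite !ffunE.
rewrite -(card_imset _ Finj) -[X in (_ ^ X)%N]card_ord -card_ffun_on.
apply/subset_leq_card/fintype.subsetP => g /imsetP[k]; rewrite inE => /forallP Pk ->.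
by apply/ffun_onP => i; rewrite ffunE; exact: Pk.
Qed.

Hypothesis N2 : (2 < N)%N.

Let N1 : (1 < N)%N. Proof. exact: ltnW. Qed.

Lemma ltn_zmod (a : 'Z_N) : (a < N)%N. Proof. by rewrite -[X in (_ < X)%N](Zp_cast N1) ltn_ord. Qed.

Lemma nbrN v : nbr (- v) = nbr v.
Proof.
rewrite /nbr /torus_dist !subr0; congr (_ == _); apply: eq_bigr => i _.
rewrite mxE /= [X in (_ %% X)%N]Zp_cast // [X in (X - _)%N]Zp_cast //.
have := ltn_zmod (v ord0 i); case: (posnP (v ord0 i)) => [-> _|v0 vN].
  by rewrite subn0 modnn !min0n.
by rewrite modn_small; lia.
Qed.

Lemma nbr_delta (i : 'I_d) : nbr (delta_mx ord0 i).
Proof.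
rewrite /nbr /torus_dist subr0 (bigD1 i) //= mxE !eqxx /=.
rewrite [X in (1 %% X)%N]Zp_cast // modn_small // big1 => [|j /negPf ji].
  by apply/eqP; lia.
by rewrite mxE eqxx ji min0n.
Qed.

(** The representative of a residue within [b] of 0 lies among the first [b + 1] or the last [b]
    integers below [N]. *)
Lemma card_zmod_near0 (b : nat) : (#|[pred a : 'Z_N | (minn a (N - a) <= b)%N]| <= b.*2.+1)%N.
Proof.
rewrite cardE -(size_map (fun a : 'Z_N => a : nat)).
have -> : b.*2.+1 = size (iota 0 b.+1 ++ iota (N - b) b).
  by rewrite size_cat !size_iota; lia.
apply: uniq_leq_size; first by rewrite map_inj_uniq ?enum_uniq //; exact: val_inj.
move=> m /mapP[a]; rewrite mem_enum inE => ab ->.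
rewrite mem_cat !mem_iota; have := ltn_zmod a; lia.
Qed.

End torus_neighbours.

Section torus_spectrum.
Context {R : realType} {d N : nat}.
Hypothesis N2 : (2 < N)%N.
Local Notation T := (torus d N).
Local Notation n := (N%:R ^+ d : R).
Local Notation gap := (1 - cos (2 * pi / N%:R) : R).
Implicit Types (f u : T -> R) (k v : T).

Let N1 : (1 < N)%N. Proof. exact: ltnW. Qed.
Let N_gt0 : 0 < N%:R :> R. Proof. by rewrite ltr0n; case: N N2. Qed.
(** Only the neighbours [e_i] and [- e_i] are kept in the sum. They are distinct because [N > 2],
    and they contribute equally. *)
Lemma symbol_ge k (i : 'I_d) :
  2 * (1 - cos (zangle (k ord0 i))) <= symbol (R := R) (E := nbr) k.
Proof.
rewrite /symbol (bigD1 (delta_mx ord0 i)) ?(nbr_delta N2) //=.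
rewrite (bigD1 (- delta_mx ord0 i)) /=; last first.
  rewrite (nbrN N2) (nbr_delta N2) /=; apply/eqP => /(congr1 (fun w : T => w ord0 i)).
  rewrite !mxE !eqxx /= => /(congr1 (fun a : 'Z_N => a : nat)) /=.
  by rewrite Zp_cast // (modn_small N1) modn_small; lia.
rewrite (cosdNr N1) /cosd dotz_delta addrA mulrDl mul1r lerDl.
by apply: sumr_ge0 => v _; rewrite subr_ge0 cos_le1.
Qed.

Lemma symbol_gap k : k != 0 -> 2 * gap <= symbol (R := R) (E := nbr) k.
Proof.
move=> /neq0_coord[i ki]; apply: le_trans (symbol_ge k i).
by rewrite ler_pM2l // one_subcos_zangle_gap.
Qed.

Lemma gap_ge0 : 0 <= gap. Proof. by rewrite subr_ge0 cos_le1. Qed.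

Lemma gap_le : gap <= 2 * pi ^+ 2 / N%:R ^+ 2.
Proof.
have pi0 := pi_gt0 R.
have h : 0 <= (2 * pi / N%:R : R) <= pi.
  rewrite divr_ge0 ?mulr_ge0 ?(ltW pi0) ?(ltW N_gt0) //= ler_pdivrMr // mulrC.
  by rewrite ler_pM2l // ler_nat ltnW.
apply: le_trans (one_subcos_le _ h) _.
by rewrite le_eqVlt; apply/orP; left; apply/eqP; field; rewrite gt_eqF.
Qed.

(** Leaving out the zero frequency makes the set empty for small [a], so that the count in
    [card_low] needs no additive constant. *)
Definition low (a : R) : {pred T} :=
  fun k => (k != 0) && (symbol (R := R) (E := nbr) k < a ^+ 2).

(** Each coordinate of a low frequency is within [b = trunc (a * N / 2)] of 0, so there are at most
    [(2 * b + 1) ^ d <= (3 * b) ^ d] of them. *)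
Lemma card_low (a : R) : 0 <= a ->
  #|[pred k | low a k]|%:R <= (3 * a / 2 * N%:R) ^+ d.
Proof.
move=> a0.
have min_lt k i : low a k -> (minn (k ord0 i) (N - k ord0 i))%:R < a * N%:R / 2.
  case/andP=> _ ka; set m := minn _ _.
  have : 4 * (m%:R / N%:R) ^+ 2 < a ^+ 2.
    apply: le_lt_trans ka; apply: le_trans (symbol_ge k i).
    by have := one_subcos_zangle_ge (R := R) N1 (k ord0 i); rewrite -/m; lra.
  have -> : 4 * (m%:R / N%:R) ^+ 2 = (2 * (m%:R / N%:R)) ^+ 2 :> R by ring.
  rewrite ltr_pXn2r ?nnegrE ?mulr_ge0 ?divr_ge0 ?(ltW N_gt0) //.
  by rewrite mulrA ltr_pdivrMr // ltr_pdivlMr // mulrC.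
have [k0 lk0|none] := pickP (low a); last first.
  by rewrite eq_card0 ?exprn_ge0 ?mulr_ge0 ?divr_ge0 ?mulr_ge0 ?(ltW N_gt0).
pose b := Num.trunc (a * N%:R / 2).
have b_le : b%:R <= a * N%:R / 2 by rewrite truncn_le // divr_ge0 // mulr_ge0 // ltW.
(* A low frequency has a nonzero coordinate, at distance at least 1 from 0; this is what allows
   [2 * b + 1 <= 3 * b]. *)
have b1 : (1 <= b)%N.
  case/andP: (lk0) => /neq0_coord[i ki] _; have := min_lt _ i lk0.
  rewrite /b truncn_gt0 => /ltW; apply: le_trans.
  rewrite ler1n leq_min subn_gt0 (ltn_zmod N2) andbT.
  by rewrite lt0n; apply: contra ki => /eqP ki; apply/eqP/val_inj.
have : (#|[pred k | low a k]| <= b.*2.+1 ^ d)%N.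
  pose P : {pred 'Z_N} := [pred x : 'Z_N | (minn x (N - x) <= b)%N].
  apply: leq_trans (leq_trans (card_rows (d := d) P) _); last first.
    by case: (d) => // e; rewrite leq_exp2r // (card_zmod_near0 N2).
  apply/subset_leq_card/fintype.subsetP => k; rewrite !inE => lk.
  apply/forallP => i; rewrite /P inE truncn_ge_nat; first by apply/ltW/min_lt.
  by rewrite divr_ge0 // mulr_ge0 // ltW.
rewrite -(@ler_nat R) natrX => /le_trans; apply.
rewrite lerXn2r ?nnegrE ?mulr_ge0 ?divr_ge0 ?mulr_ge0 ?(ltW N_gt0) //.
have b1r : 1 <= b%:R :> R by rewrite ler1n.
rewrite -addn1 -muln2 natrD natrM; lra.
Qed.

End torus_spectrum.

(** * Nash inequality and spectral gap of the slowed walk *)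

Section functional_inequalities.
Context {R : realType} {d N : nat}.
Hypothesis N2 : (2 < N)%N.
Local Notation T := (torus d N).
Local Notation n := (N%:R ^+ d : R).
Local Notation gap := (1 - cos (2 * pi / N%:R) : R).
Local Notation dirichlet := (dirichlet (E := @nbr d N)).
Local Notation dirichlet_at0 := (dirichlet_at0 (E := @nbr d N)).
Local Notation symbol := (symbol (R := R) (E := @nbr d N)).
Implicit Types (f u : T -> R) (k v : T).

Let N1 : (1 < N)%N. Proof. exact: ltnW. Qed.
Let N_gt0 : 0 < N%:R :> R. Proof. by rewrite ltr0n; case: N N2. Qed.
Let n_gt0 : 0 < n. Proof. exact: exprn_gt0. Qed.
Let nbrN v : nbr (- v) = nbr v. Proof. exact: nbrN. Qed.

Lemma hartley0 f : hartley f 0 = \sum_x f x.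
Proof. by apply: eq_bigr => x _; rewrite cas0 mulr1. Qed.

Lemma hartley_cst (c : R) k : k != 0 -> hartley (fun=> c) k = 0.
Proof.
move=> k0; rewrite /hartley /inner -mulr_sumr.
have := cas_ortho (R := R) N1 k 0 N2; rewrite (negPf k0) mulr0.
by under eq_bigr do rewrite cas0 mulr1; move=> ->; rewrite mulr0.
Qed.

(* Jensen's inequality *)
Lemma hartley_pmf_le u k : (forall x, 0 <= u x) -> \sum_x u x = 1 ->
  hartley u k ^+ 2 <= 2.
Proof.
move=> u0 u1; set m := hartley u k.
have : 0 <= \sum_x u x * (cas k x - m) ^+ 2.
  by apply: sumr_ge0 => x _; rewrite mulr_ge0 ?sqr_ge0.
have -> : \sum_x u x * (cas k x - m) ^+ 2 = \sum_x u x * cas k x ^+ 2 - m ^+ 2.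
  transitivity (\sum_x (u x * cas k x ^+ 2 - 2 * m * (u x * cas k x) + m ^+ 2 * u x)).
    by apply: eq_bigr => x _; ring.
  by rewrite big_split sumrB /= -!mulr_sumr u1 -/(inner u (cas k)) -/(hartley u k) -/m; ring.
have : \sum_x u x * cas k x ^+ 2 <= \sum_x u x * 2.
  by apply: ler_sum => x _; rewrite ler_wpM2l ?cas_sqr_le2.
rewrite -mulr_suml u1; lra.
Qed.

(* The frequencies with symbol below a^2 are few, and the other ones are
   controlled by the energy. *)
Lemma nash u (a : R) (w := fun x => u x - n^-1) :
  (forall x, 0 <= u x) -> \sum_x u x = 1 -> 0 <= a ->
  a ^+ 2 * (inner w w - 2 * (3 * a / 2) ^+ d) <= dirichlet w.
Proof.
move=> u0 u1 a0.
have w0 : hartley w 0 = 0.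
  rewrite hartley0 sumrB u1 sumr_const -[_ *+ #|_|]mulr_natr.
  by rewrite (card_torus N1) mulVf ?subrr // gt_eqF.
have wk k : k != 0 -> hartley w k = hartley u k.
  by move=> k0; rewrite hartleyB hartley_cst // subr0.
rewrite (dirichletE N1 N2 nbrN) (parseval N1 N2).
pose L : R := #|[pred k : T | low a k]|%:R.
(* Frequency by frequency: at a low one the squared coefficient is at most 2 by [hartley_pmf_le], at
   a high one [a ^+ 2] is at most the symbol. *)
have key : a ^+ 2 * \sum_k hartley w k * hartley w k <=
    \sum_k symbol k * hartley w k ^+ 2 + 2 * a ^+ 2 * L.
  rewrite /L -sum1_card natr_sum !mulr_sumr [X in _ + X]big_mkcond -big_split.
  apply: ler_sum => k _ /=; rewrite unfold_in /= -expr2.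
  have [->|k0] := eqVneq k 0.
    by rewrite w0 expr0n !mulr0 add0r; case: ifP; rewrite // mulr1 mulr_ge0 ?sqr_ge0.
  have := sqr_ge0 (hartley w k); have := symbol_ge0 (R := R) (E := @nbr d N) k.
  rewrite /low k0 /=; case: ltP => [_|]; last by nra.
  have : hartley w k ^+ 2 <= 2 by rewrite wk // hartley_pmf_le.
  have := sqr_ge0 a; rewrite mulr1; nra.
have Ln : n^-1 * L <= (3 * a / 2) ^+ d.
  by rewrite mulrC ler_pdivrMr // -exprMn; exact: card_low.
rewrite mulrBr lerBlDr mulrCA.
apply: le_trans (_ : n^-1 * (\sum_k symbol k * hartley w k ^+ 2 + 2 * a ^+ 2 * L) <= _).
  by rewrite ler_pM2l ?invr_gt0.
rewrite mulrDr lerD2l.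
have := ler_wpM2l (_ : 0 <= 2 * a ^+ 2) Ln; rewrite mulr_ge0 ?sqr_ge0 // => /(_ isT).
by move: (n^-1) (_ ^+ d) => ni q; lra.
Qed.

(** [96 * pi ^+ 2] bounds [48 * gap * N ^ 2], with 48 = 3 * 16 from the bounds [locf] and [locf1]
    below, and [(6 * pi) ^+ d] bounds the number of low frequencies. *)
Definition gap_defect : R := 96 * pi ^+ 2 * (6 * pi) ^+ d.

(* The frequencies with symbol below 8 gap are boundedly many and their
   gradients at 0 are O(1/N). On the other ones, a quarter of the energy already
   dominates 2 gap. *)
Lemma slowed_gap f : \sum_x f x = 0 ->
  (2 * gap - gap_defect / N%:R ^+ (d + 2)) * inner f f <=
  dirichlet f - dirichlet_at0 f.
Proof.
move=> f0; pose a := Num.sqrt (8 * gap).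
have g0 := gap_ge0 (R := R) (N := N).
have a2 : a ^+ 2 = 8 * gap by rewrite sqr_sqrtr // mulr_ge0.
pose A := low (R := R) (d := d) (N := N) a.
pose f1 := lowpass A f; pose h := fun x => f x - f1 x.
have Hf1 k : hartley f1 k = (A k)%:R * hartley f k by exact: hartley_lowpass.
have Hh k : hartley h k = (~~ A k)%:R * hartley f k.
  by rewrite /h hartleyB Hf1; case: (A k); rewrite /= ?mul1r ?mul0r ?subrr ?subr0.
pose S := \sum_(k | A k) hartley f k ^+ 2.
have innerf1 : inner f1 f1 = n^-1 * S.
  rewrite (parseval N1 N2); congr (_ * _); rewrite /S [RHS]big_mkcond.
  by apply: eq_bigr => k _; rewrite !Hf1; case: (A k); rewrite ?mul1r ?mul0r // expr2.
have innerD : inner f f = inner f1 f1 + inner h h.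
  rewrite !(parseval N1 N2) -mulrDr -big_split; congr (_ * _).
  by apply: eq_bigr => k _; rewrite Hf1 Hh; case: (A k);
    rewrite /= ?mul1r ?mul0r ?expr0n ?mulr0 ?addr0 ?add0r.
have dirD : dirichlet f = dirichlet f1 + dirichlet h.
  rewrite !(dirichletE N1 N2 nbrN) -mulrDr -big_split; congr (_ * _).
  by apply: eq_bigr => k _; rewrite Hf1 Hh; case: (A k);
    rewrite /= ?mul1r ?mul0r ?expr0n ?mulr0 ?addr0 ?add0r.
have dir1 : 2 * gap * inner f1 f1 <= dirichlet f1.
  rewrite (dirichletE N1 N2 nbrN) (parseval N1 N2) mulrCA ler_pM2l ?invr_gt0 //.
  rewrite mulr_sumr; apply: ler_sum => k _; rewrite -expr2.
  have [->|k0] := eqVneq k 0; first by rewrite Hf1 hartley0 f0 mulr0 expr0n !mulr0.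
  by rewrite ler_wpM2r ?sqr_ge0 ?symbol_gap.
have dir2 : 8 * gap * inner h h <= dirichlet h.
  rewrite (dirichletE N1 N2 nbrN) (parseval N1 N2) mulrCA ler_pM2l ?invr_gt0 //.
  rewrite mulr_sumr; apply: ler_sum => k _; rewrite -expr2 Hh.
  have [->|k0] := eqVneq k 0; first by rewrite hartley0 f0 mulr0 expr0n !mulr0.
  rewrite -a2 /A /low k0 /=; case: ltP => [_|ak]; first by rewrite !mul0r expr0n !mulr0.
  by rewrite ler_wpM2r ?sqr_ge0.
have loch : dirichlet_at0 h <= dirichlet h / 2 by apply: dirichlet_at0_le; rewrite ?nbr0.
(* [(p + q)^2 <= 3 p^2 + (3/2) q^2], the difference being half of [(2 p - q)^2]. With the weight 3/2
   and [loch], the high part keeps 1 - 3/4 of its energy. *)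
have locf : dirichlet_at0 f <= 3 * dirichlet_at0 f1 + 3 / 2 * dirichlet_at0 h.
  rewrite /dirichlet_at0 !(mulrCA _ 2^-1) -mulrDr ler_pM2l ?invr_gt0 //.
  rewrite !mulr_sumr -big_split; apply: ler_sum => v _ /=; rewrite /h.
  by have := sqr_ge0 (2 * (f1 0 - f1 v) - (f 0 - f1 0 - (f v - f1 v))); nra.
pose L : R := #|[pred k : T | A k]|%:R.
(* Cauchy-Schwarz over the low frequencies; summing over the neighbours then rebuilds the symbols,
   each below [8 * gap]. The constant is 16 = 4 * 8 / 2. *)
have locf1 : dirichlet_at0 f1 <= 16 * gap * (n^-1 * L) * inner f1 f1.
  (* [(1 - c - s)^2 + (1 - c + s)^2 = 4 (1 - c)] on the unit circle. *)
  have casd k v : (cas k 0 - cas k v) ^+ 2 <= 4 * (1 - cosd (R := R) k v).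
    rewrite (casC k 0) cas0 /cas; have := cos2Dsin2 (zangle (dotz k v) : R).
    rewrite -/(cosd k v) -/(sind k v); move: (cosd _ _) (sind _ _) => c s.
    by have := sqr_ge0 (1 - c - s); have := sqr_ge0 (1 - c + s); nra.
  have Sge0 : 0 <= S by apply: sumr_ge0 => k _; exact: sqr_ge0.
  have step v : (f1 0 - f1 v) ^+ 2 <=
      n^-1 ^+ 2 * S * (4 * \sum_(k | A k) (1 - cosd (R := R) k v)).
    have -> : f1 0 - f1 v =
        n^-1 * \sum_(k | A k) hartley f k * (cas k 0 - cas k v).
      rewrite /f1 /lowpass -mulrBr -sumrB; congr (_ * _).
      by apply: eq_bigr => k _; rewrite mulrBr.
    rewrite exprMn -mulrA ler_wpM2l ?sqr_ge0 //.
    apply: le_trans (cauchy_schwarz_sum _ _ _ _ _) _; rewrite ler_wpM2l // mulr_sumr.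
    by apply: ler_sum.
  have symb : \sum_(v | nbr v) \sum_(k | A k) (1 - cosd (R := R) k v) <= 8 * gap * L.
    rewrite exchange_big /= /L -sum1_card natr_sum mulr_sumr.
    apply: ler_sum => k; rewrite -a2 mulr1 => /andP[_ /ltW]; exact.
  rewrite innerf1; apply: le_trans (_ : 2^-1 * \sum_(v | nbr v)
      (n^-1 ^+ 2 * S * (4 * \sum_(k | A k) (1 - cosd (R := R) k v))) <= _).
    by rewrite ler_pM2l ?invr_gt0 //; apply: ler_sum.
  rewrite -mulr_sumr -mulr_sumr.
  have := ler_wpM2l (_ : 0 <= 2 * (n^-1 ^+ 2 * S)) symb.
  rewrite mulr_ge0 ?mulr_ge0 ?sqr_ge0 // => /(_ isT).
  by move: (n^-1) => ni; lra.
(* [a ^+ 2 = 8 * gap <= 16 * pi ^+ 2 / N ^ 2], so [3 * a / 2 * N <= 6 * pi]. *)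
have Lle : L <= (6 * pi) ^+ d.
  apply: (le_trans (card_low (d := d) N2 a (sqrtr_ge0 _))).
  have aN : a * N%:R <= 4 * pi.
    rewrite -ler_pdivlMr // -(@ler_pXn2r _ 2) ?nnegrE ?sqrtr_ge0 //; last first.
      by rewrite divr_ge0 ?mulr_ge0 ?pi_ge0 ?(ltW N_gt0).
    rewrite a2 expr_div_n exprMn; have := gap_le (R := R) N2; lra.
  rewrite lerXn2r ?nnegrE ?mulr_ge0 ?divr_ge0 ?mulr_ge0 ?sqrtr_ge0 ?pi_ge0 ?(ltW N_gt0) //.
  rewrite -/a; lra.
have defect : 48 * gap * (n^-1 * L) <= gap_defect / N%:R ^+ (d + 2).
  apply: le_trans (_ : (96 * pi ^+ 2 / N%:R ^+ 2) * (n^-1 * (6 * pi) ^+ d) <= _).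
    apply: ler_pM; rewrite ?mulr_ge0 ?invr_ge0 ?(ltW n_gt0) ?ler_wpM2l ?invr_ge0 ?(ltW n_gt0) //.
    by have := gap_le (R := R) N2; lra.
  rewrite /gap_defect exprD le_eqVlt; apply/orP; left; apply/eqP.
  by field; rewrite !gt_eqF.
have X0 : 0 <= inner h h by apply: sumr_ge0 => x _; rewrite -expr2 sqr_ge0.
have X1 : 0 <= inner f1 f1 by apply: sumr_ge0 => x _; rewrite -expr2 sqr_ge0.
have B0 : 0 <= gap_defect / N%:R ^+ (d + 2).
  by rewrite /gap_defect divr_ge0 ?mulr_ge0 ?exprn_ge0 ?mulr_ge0 ?pi_ge0 ?(ltW N_gt0).
move: defect B0; set B := gap_defect / _ => defect B0.
have := ler_wpM2r X1 defect.
have : 0 <= B * inner h h by exact: mulr_ge0.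
rewrite innerD; lra.
Qed.

End functional_inequalities.

(** * Markov semigroups *)

Section semigroup_calculus.
Context {R : realType} {K : topologicalType}.
Context (S : R -> (K -> R) -> K -> R) (L : (K -> R) -> K -> R).
Hypotheses (Ssemi : markov_semigroup S) (SL : has_generator S L).
Implicit Types f g : K -> R.

Lemma uniform_cvg0_right (F : R -> K -> R) g : {uniform, F t @[t --> 0^'+] --> g} ->
  forall e : R, 0 < e -> exists2 del, 0 < del &
    forall h, 0 < h < del -> forall x, `|F h x - g x| <= e.
Proof.
move=> Fg e e0.
have : nbhs (g : {uniform K -> R}) [set h : K -> R | forall x, `|h x - g x| <= e].
  apply/uniform_nbhs; exists [set xy : R * R | ball xy.1 e xy.2]; split.
    exact: (entourage_ball R (PosNum e0)).
  by move=> h /= hg x; have := hg x Logic.I; rewrite /ball /= distrC => /ltW.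
move=> /Fg [del /= del0 hdel]; exists del => // h /andP[h0 hd].
by apply: hdel => //=; rewrite sub0r normrN gtr0_norm.
Qed.

Lemma semigroup_cst (t c : R) (x : K) : 0 <= t -> S t (fun=> c) x = c.
Proof.
move=> t0; have c1 : continuous (fun _ : K => 1 : R) by exact: cst_continuous.
have := semigroup_linear Ssemi (c - 1) t0 c1 c1 x.
by rewrite (semigroup_cst1 Ssemi) // mulr1 subrK.
Qed.

Lemma semigroup_sub (t : R) f g x : 0 <= t -> continuous f -> continuous g ->
  S t (fun y => f y - g y) x = S t f x - S t g x.
Proof.
move=> t0 cf cg; have := semigroup_linear Ssemi (-1) t0 cg cf x.
rewrite mulN1r addrC => <-; congr (S t _ x); apply/funext => y.
by rewrite mulN1r addrC.
Qed.

Lemma semigroup_scale (t c : R) f (x : K) : 0 <= t -> continuous f ->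
  S t (fun y => c * f y) x = c * S t f x.
Proof.
move=> t0 cf; have c0 : continuous (fun _ : K => 0 : R) by exact: cst_continuous.
rewrite -[RHS]addr0 -[X in _ + X](semigroup_cst t 0 x) // -(semigroup_linear Ssemi) //.
by congr (S t _ x); apply/funext => y; rewrite addr0.
Qed.

Lemma semigroup_sum (t : R) (I : Type) (r : seq I) (P : pred I) (F : I -> K -> R) (x : K) :
  0 <= t -> (forall i, continuous (F i)) ->
  S t (fun y => \sum_(i <- r | P i) F i y) x = \sum_(i <- r | P i) S t (F i) x.
Proof.
move=> t0 cF; elim: r => [|i r IH].
  rewrite big_nil -[RHS](semigroup_cst t 0 x) //.
  by congr (S t _ x); apply/funext => y; rewrite big_nil.
rewrite big_cons (_ : (fun _ => _) =
    (fun y => (if P i then 1 else 0) * F i y + \sum_(j <- r | P j) F j y)).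
  rewrite (semigroup_linear Ssemi) //; last exact: continuous_sum_seq.
  by rewrite IH; case: (P i); rewrite ?mul1r // mul0r add0r.
by apply/funext => y; rewrite big_cons; case: (P i); rewrite ?mul1r // mul0r add0r.
Qed.

(** Contraction in the sup norm: positivity applied to [e - f] and [e + f], constants being
    preserved. *)
Lemma semigroup_le_norm (t : R) f (e : R) (x : K) : 0 <= t -> continuous f ->
  (forall y, `|f y| <= e) -> `|S t f x| <= e.
Proof.
move=> t0 cf fe; have ce : continuous (fun _ : K => e) by exact: cst_continuous.
have cNf : continuous (fun y => -1 * f y) by move=> y; apply: cvgMr; exact: cf.
have hi : 0 <= e - S t f x.
  rewrite -{1}(semigroup_cst t e x t0) -semigroup_sub //.
  apply: (semigroup_ge0 Ssemi) => //; first exact: continuous_sub.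
  by move=> y; have := fe y; rewrite ler_norml; lra.
have lo : 0 <= e - -1 * S t f x.
  rewrite -{1}(semigroup_cst t e x t0) -semigroup_scale // -semigroup_sub //.
  apply: (semigroup_ge0 Ssemi) => //; first exact: continuous_sub.
  by move=> y; have := fe y; rewrite ler_norml; lra.
by rewrite ler_norml; lra.
Qed.

(** For [t <= s] the difference is [S t] applied to [S (s - t) f - f], so contraction carries strong
    continuity at 0 to all times at once. *)
Lemma semigroup_unif_continuous f (e : R) : continuous f -> 0 < e ->
  exists2 del, 0 < del & forall s t x, 0 <= s -> 0 <= t -> `|s - t| < del ->
    `|S s f x - S t f x| <= e.
Proof.
move=> cf e0; have [del del0 hdel] := uniform_cvg0_right _ _ (semigroup_strong Ssemi cf) _ e0.
exists del => // s t x.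
wlog ts : s t / t <= s.
  move=> H s0 t0 st; case: (leP t s) => [ts|/ltW ts]; first exact: H.
  by rewrite distrC; apply: H => //; rewrite distrC.
move=> s0 t0; rewrite ger0_norm ?subr_ge0 // => st.
have [->|nts] := eqVneq s t; first by rewrite subrr normr0 ltW.
have h0 : 0 < s - t by rewrite subr_gt0 lt_neqAle eq_sym nts.
have cSf : continuous (S (s - t) f) by apply: (semigroup_continuous Ssemi) => //; exact: ltW.
rewrite (_ : S s f x = S t (S (s - t) f) x); last first.
  by rewrite -(semigroup_add Ssemi) ?(ltW h0) //; congr (S _ f x); ring.
rewrite -semigroup_sub //; apply: semigroup_le_norm => //; first exact: continuous_sub.
by move=> y; apply: hdel; rewrite h0.
Qed.

Lemma semigroup_right_derive f (e : R) : continuous f -> continuous (L f) -> 0 < e ->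
  exists2 del, 0 < del & forall t h x, 0 <= t -> 0 < h < del ->
    `|h^-1 * (S (t + h) f x - S t f x) - S t (L f) x| <= e.
Proof.
move=> cf cLf e0; have [del del0 hdel] := uniform_cvg0_right _ _ (SL _ cf) _ e0.
exists del => // t h x t0 hh; case/andP: (hh) => h0 _.
have cSf : continuous (S h f) by apply: (semigroup_continuous Ssemi) => //; exact: ltW.
have cq : continuous (fun y => h^-1 * (S h f y - f y)).
  by move=> y; apply: cvgMr; apply: continuous_sub.
rewrite (semigroup_add Ssemi) ?(ltW h0) // -semigroup_sub //.
rewrite -semigroup_scale //; last exact: continuous_sub.
rewrite -semigroup_sub //; apply: semigroup_le_norm => //; first exact: continuous_sub.
by move=> y; exact: hdel.
Qed.

(** The generator only gives right derivatives, but uniformly in the base time. A left quotient at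
    [t] is a right quotient at [t + h] with [h < 0]; it is close to [S (t + h) (L f)], hence to
    [S t (L f)]. *)
Lemma is_derive_semigroup f (t : R) (x : K) : continuous f -> continuous (L f) -> 0 < t ->
  is_derive t 1 (fun s : R => S s f x) (S t (L f) x).
Proof.
move=> cf cLf t0.
suff dq : (fun h : R => h^-1 *: (((fun s : R => S s f x) \o shift t) (h *: 1) - S t f x))
    @ 0^' --> S t (L f) x.
  by apply: DeriveDef; [apply/cvg_ex; exists (S t (L f) x)|exact: cvg_lim].
apply/cvgrPdist_le => e e0.
have e20 : 0 < e / 2 by rewrite divr_gt0.
have [d1 d10 h1] := semigroup_right_derive _ _ cf cLf e20.
have [d2 d20 h2] := semigroup_unif_continuous _ _ cLf e20.
exists (Num.min t (Num.min d1 d2)) => /=; first by rewrite !lt_min t0 d10.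
move=> h /=; rewrite sub0r normrN !lt_min => /and3P[ht hd1 hd2] hn0.
rewrite /shift /= [h *: 1]mulr1 distrC [_ *: _]/(_ * _).
case: (ltgtP h 0) => [hneg|hpos|h00]; last by rewrite h00 eqxx in hn0.
- have E : `|h| = - h by rewrite ltr0_norm.
  have th : 0 <= t + h by move: ht; rewrite E; lra.
  have := h1 (t + h) (- h) x th; rewrite -{1 2}E normr_gt0 hn0 hd1 => /(_ isT).
  rewrite addrK => A.
  have := h2 (t + h) t x th (ltW t0); rewrite addrAC subrr add0r => /(_ hd2) B.
  have -> : h^-1 * (S (h + t) f x - S t f x) - S t (L f) x =
      ((- h)^-1 * (S t f x - S (t + h) f x) - S (t + h) (L f) x) +
      (S (t + h) (L f) x - S t (L f) x).
    by rewrite invrN [h + t]addrC; ring.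
  by apply: le_trans (ler_normD _ _) _; rewrite [leRHS]splitr lerD.
- rewrite [h + t]addrC.
  apply: (le_trans (h1 t h x (ltW t0) _)); last by rewrite ler_pdivrMr //; lra.
  by rewrite hpos -[X in X < _](gtr0_norm hpos).
Qed.

(* Extending the orbit by a constant to negative times makes it continuous on
   the whole real line. *)
Definition orbit f (x : K) (t : R) : R := S (Num.max t 0) f x.

Lemma continuous_orbit f (x : K) : continuous f -> continuous (orbit f x).
Proof.
move=> cf t; apply/cvgrPdist_le => e e0.
have [del del0 h] := semigroup_unif_continuous _ _ cf e0.
exists del => //= s /= st; apply: h; rewrite ?le_max ?lexx ?orbT //.
apply: le_lt_trans st; rewrite /Num.max.
have := ler_norm (t - s); have := ler_norm (s - t); rewrite distrC.
by case: ltP => ?; case: ltP => ?; rewrite ler_norml; lra.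
Qed.

Lemma is_derive_orbit f (t : R) (x : K) : continuous f -> continuous (L f) -> 0 < t ->
  is_derive t 1 (orbit f x) (orbit (L f) x t).
Proof.
move=> cf cLf t0; rewrite {2}/orbit max_l ?(ltW t0) //.
have := is_derive_semigroup f t x cf cLf t0; apply: near_eq_is_derive.
exists t => //= s /= st; rewrite /orbit max_l //.
by have := ler_norm (t - s); lra.
Qed.

End semigroup_calculus.

(** * Heat flow of the slowed walk *)

Section slowed_heat_flow.
Context {R : realType} {d N : nat}.
Hypotheses (d1 : (1 <= d)%N) (N2 : (2 < N)%N).
Local Notation T := (torus d N).
Local Notation n := (N%:R ^+ d : R).
Local Notation gap := (1 - cos (2 * pi / N%:R) : R).
Local Notation dirichlet := (dirichlet (E := @nbr d N)).
Local Notation dirichlet_at0 := (dirichlet_at0 (E := @nbr d N)).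
Local Notation slowed_laplacian := (slowed_laplacian (E := @nbr d N)).

Variable u : T -> R -> R.
Hypothesis u_continuous : forall z, continuous (u z).
Hypothesis u_derive : forall z (t : R), 0 < t ->
  is_derive t 1 (u z) (slowed_laplacian (u ^~ t) z).
Hypothesis u0 : forall z, u z 0 = (z == 0)%:R.
Hypothesis u_ge0 : forall z (t : R), 0 <= t -> 0 <= u z t.
Hypothesis u_sum : forall t : R, 0 <= t -> \sum_z u z t = 1.

Let N_gt0 : 0 < N%:R :> R. Proof. by rewrite ltr0n; case: N N2. Qed.
Let n_gt0 : 0 < n. Proof. exact: exprn_gt0. Qed.
Let N1 : (1 < N)%N. Proof. exact: ltnW. Qed.

(* sum_x u_{t+s}(x) u_{t-s}(x) does not depend on s. *)
Lemma diag_double (t : R) : 0 <= t -> u 0 (t + t) = inner (u ^~ t) (u ^~ t).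
Proof.
move=> t0; pose phi s := \sum_x u x (t + s) * u x (t - s).
have -> : u 0 (t + t) = phi t.
  rewrite /phi (bigD1 0) //= subrr u0 eqxx mulr1 big1 ?addr0 // => x /negPf x0.
  by rewrite u0 x0 mulr0.
have -> : inner (u ^~ t) (u ^~ t) = phi 0.
  by apply: eq_bigr => x _; rewrite addr0 subr0.
have cphi : continuous phi.
  apply: continuous_sum_seq => x s; apply: cvgM; apply: continuous_comp; try exact: u_continuous.
    by apply: cvgD; [exact: cvg_cst|exact: cvg_id].
  by apply: cvgB; [exact: cvg_cst|exact: cvg_id].
(* The derivative is the difference of two pairings that agree because [slowed_laplacian] is
   symmetric. *)
have dphi s : 0 < s < t -> is_derive s 1 phi 0.
  move=> /andP[s0 st].
  have dp x : is_derive s 1 (fun r => u x (t + r)) (slowed_laplacian (u ^~ (t + s)) x).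
    rewrite -[slowed_laplacian _ _]mulr1; apply: (is_derive1_comp (g := fun r => t + r)).
      by apply: u_derive; rewrite addr_gt0 // (lt_trans s0).
    by rewrite -[X in is_derive _ _ _ X]add0r; apply: is_deriveD.
  have dm x : is_derive s 1 (fun r => u x (t - r)) (- slowed_laplacian (u ^~ (t - s)) x).
    rewrite -[slowed_laplacian _ _]mulr1 -mulrN; apply: (is_derive1_comp (g := fun r => t - r)).
      by apply: u_derive; rewrite subr_gt0.
    by rewrite -[X in is_derive _ _ _ X]add0r; apply: is_deriveB.
  apply: is_derive_eq (is_derive_sum_seq _ (index_enum T) _ _ s
    (fun x => is_derive_mul _ _ _ _ _ (dp x) (dm x))) _.
  rewrite big_split /=.
  under eq_bigr do rewrite mulrN.
  rewrite sumrN -[X in _ + X]/(inner _ _) -[X in - X]/(inner _ _).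
  by rewrite inner_slowed_laplacianC ?addNr //; exact: nbrN.
apply/le_anti/andP; split.
  apply: (derive_le0_nincr phi (fun=> 0) 0 t t0) => //; exact: continuous_subspaceT.
rewrite -lerN2.
apply: (derive_le0_nincr (fun s => - phi s) (fun=> 0) 0 t t0) => //.
  by move=> s st; rewrite -oppr0; apply: is_deriveN; exact: dphi.
by apply: continuous_subspaceT => s; apply: cvgN; exact: cphi.
Qed.

Definition dev (t : R) (x : T) : R := u x t - n^-1.
Definition energy (t : R) : R := inner (dev t) (dev t).

Lemma sum_uniform : \sum_(x : T) n^-1 = 1.
Proof.
by rewrite sumr_const -[_ *+ #|_|]mulr_natr (card_torus N1) mulVf // gt_eqF.
Qed.

Lemma sum_dev (t : R) : 0 <= t -> \sum_x dev t x = 0.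
Proof.
by move=> t0; rewrite sumrB u_sum // sum_uniform subrr.
Qed.

(** Removing the mean lowers the squared norm by [N ^ (- d)]. Up to the factor [N ^ d], the energy
    at [t] is thus the quantity to bound at time [2 t]. *)
Lemma energyE (t : R) : 0 <= t -> energy t = u 0 (t + t) - n^-1.
Proof.
move=> t0; rewrite diag_double // /energy /inner.
transitivity (\sum_x (u x t * u x t - 2 * n^-1 * u x t + n^-1 * n^-1)).
  by apply: eq_bigr => x _; rewrite /dev; ring.
by rewrite big_split sumrB /= -!mulr_sumr u_sum // sum_uniform; ring.
Qed.

Lemma energy_ge0 (t : R) : 0 <= energy t.
Proof. by apply: sumr_ge0 => x _; rewrite -expr2 sqr_ge0. Qed.

Lemma energy_le1 (t : R) : 0 <= t -> energy t <= 1.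
Proof.
move=> t0; rewrite energyE //; have tt : 0 <= t + t by rewrite addr_ge0.
have : u 0 (t + t) <= 1.
  by rewrite -(u_sum _ tt) (bigD1 0) //= lerDl sumr_ge0 // => z _; exact: u_ge0.
have : 0 <= n^-1 by rewrite invr_ge0 ltW.
lra.
Qed.

Lemma continuous_energy : continuous energy.
Proof.
apply: continuous_sum_seq => x s; apply: cvgM; apply: cvgB;
  by [exact: u_continuous | exact: cvg_cst].
Qed.

Lemma is_derive_energy (t : R) : 0 < t ->
  is_derive t 1 energy (- 2 * (dirichlet (dev t) - dirichlet_at0 (dev t))).
Proof.
move=> t0.
(* The generator kills constants, so the deviation solves the same equation. *)
have Lw x : slowed_laplacian (u ^~ t) x = slowed_laplacian (dev t) x.
  rewrite /slowed_laplacian /laplacian /dev; congr (_ + _ * _).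
    by apply: eq_bigr => v _; ring.
  by apply: eq_bigr => v _; congr (_ * _); ring.
have dw x : is_derive t 1 (fun s => dev s x) (slowed_laplacian (dev t) x).
  rewrite -Lw -[slowed_laplacian _ _]subr0; apply: is_deriveB; exact: u_derive.
apply: is_derive_eq (is_derive_sum_seq _ (index_enum T) _ _ t
  (fun x => is_derive_mul _ _ _ _ _ (dw x) (dw x))) _.
rewrite big_split /= -/(inner _ _) -[X in _ + X]/(inner _ _).
rewrite [X in _ + X]innerC inner_slowed_laplacian_id; last exact: nbrN.
by ring.
Qed.

(** Gronwall: by [slowed_gap], [energy r * expR (g * r)] is nonincreasing. *)
Lemma energy_exp_decay (s t : R) : 0 <= s <= t ->
  energy t <= energy s * expR (- (2 * (2 * gap - gap_defect (d := d) / N%:R ^+ (d + 2)) * (t - s))).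
Proof.
move=> /andP[s0 st]; set g := 2 * _.
suff : energy t * expR (g * t) <= energy s * expR (g * s).
  by rewrite -ler_pdivlMr ?expR_gt0 // -mulrA -expRN -expRD => /le_trans; apply;
     rewrite -mulrBr -mulrN opprB.
apply: (derive_le0_nincr (fun r => energy r * expR (g * r))
  (fun r => energy r * (g * expR (g * r)) +
     (- 2 * (dirichlet (dev r) - dirichlet_at0 (dev r))) * expR (g * r)) s t st).
- move=> r /andP[sr rt]; apply: is_derive_mul.
    apply: is_derive_energy; exact: le_lt_trans sr.
  rewrite mulrC; apply: (is_derive1_comp (f := expR) (g := fun x => g * x)).
  by rewrite -[X in is_derive _ _ _ X]mulr1; apply: is_deriveZ.
- move=> r /andP[sr rt]; rewrite mulrA -mulrDl pmulr_lle0 ?expR_gt0 //.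
  have := slowed_gap N2 (dev r) (sum_dev _ (ltW (le_lt_trans s0 sr))).
  by rewrite -/(energy r) /g; lra.
- apply: continuous_subspaceT => r; apply: cvgM; first exact: continuous_energy.
  apply: continuous_comp; last exact: continuous_expR.
  by apply: cvgMr; exact: cvg_id.
Qed.

(** The 4 is the 2 in front of the power in [nash], times the ratio 2 of the exponents [d + d] and
    [d] in [psi] below; the power comes from the scale [a = sqrt d / r]. *)
Definition nash_cst : R := 4 * (3 * Num.sqrt d%:R / 2) ^+ d.

(* Nash's inequality at the scale a = sqrt d / r makes
   r^(2d) energy(r^2) - nash_cst r^d nonincreasing in r. *)
Lemma energy_poly_decay (s : R) : 0 <= s -> s ^+ d * energy (s ^+ 2) <= nash_cst.
Proof.
rewrite le_eqVlt => /predU1P[<-|s0].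
  by rewrite expr0n gtn_eqF // mul0r /nash_cst mulr_ge0 // exprn_ge0 //
             divr_ge0 // mulr_ge0 ?sqrtr_ge0.
suff : s ^+ (d + d) * energy (s ^+ 2) - nash_cst * s ^+ d <= 0.
  rewrite subr_le0 exprD [nash_cst * _]mulrC -mulrA ler_pM2l ?exprn_gt0 //.
(* Time is written [r ^+ 2], which turns the half-integer power of time into the integer power
   [r ^+ d]. *)
pose psi r := r ^+ (d + d) * energy (r ^+ 2) - nash_cst * r ^+ d.
have <- : psi 0 = 0 by rewrite /psi !expr0n addn_eq0 gtn_eqF // !mul0r mulr0 subrr.
pose E' r := - 2 * (dirichlet (dev (r ^+ 2)) - dirichlet_at0 (dev (r ^+ 2))).
have dX m (r : R) : is_derive r 1 (fun x => x ^+ m) (m%:R * r ^+ m.-1).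
  rewrite (_ : (fun x => x ^+ m) = id ^+ m); last by rewrite exprfctE.
  by apply: is_derive_eq (is_deriveX m (is_derive_id r 1)) _; rewrite [_ *: _]mulr1.
apply: (derive_le0_nincr psi (fun r => r ^+ (d + d) * (E' r * (2 * r)) +
   ((d + d)%:R * r ^+ (d + d).-1) * energy (r ^+ 2) - nash_cst * (d%:R * r ^+ d.-1)) 0 s (ltW s0)).
- move=> r /andP[r0 rs].
  have dE : is_derive r 1 (fun x => energy (x ^+ 2)) (E' r * (2 * r)).
    apply: (is_derive1_comp (f := energy) (g := fun x => x ^+ 2)).
    by apply: is_derive_energy; rewrite exprn_gt0.
  have dM := is_derive_mul _ _ _ _ _ (dX (d + d)%N r) dE.
  exact: (is_deriveB dM (is_deriveZ nash_cst (dX d r))).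
- move=> r /andP[r0 rs].
  (* This scale gives [r ^+ 2 * a ^+ 2 = d]: since the slowdown removes at most half of the energy,
     Nash's bound on the dissipation then exactly absorbs the terms from differentiating the powers
     of [r]. *)
  pose a := Num.sqrt d%:R / r.
  have a0 : 0 <= a by rewrite divr_ge0 ?sqrtr_ge0 ?ltW.
  have := nash N2 (u ^~ (r ^+ 2)) a (fun x => u_ge0 x _ (sqr_ge0 r)) (u_sum _ (sqr_ge0 r)) a0.
  rewrite -/(energy (r ^+ 2)).
  have := dirichlet_at0_le (nbrN N2) nbr0 (dev (r ^+ 2)).
  rewrite /E' /nash_cst; move: (dirichlet _) (dirichlet_at0 _) (energy _) => D D0 E D0le DE.
  have a2 : r ^+ 2 * a ^+ 2 = d%:R.
    by rewrite -exprMn mulrC /a divfK ?gt_eqF // sqr_sqrtr.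
  have -> : (3 * Num.sqrt d%:R / 2) ^+ d = r ^+ d * (3 * a / 2) ^+ d.
    by rewrite -exprMn; congr (_ ^+ _); rewrite /a; field; rewrite gt_eqF.
  have -> : r ^+ (d + d) = r ^+ d.-1 * r ^+ d * r.
    by rewrite -exprD -exprSr; congr (_ ^+ _); lia.
  have -> : r ^+ (d + d).-1 = r ^+ d.-1 * r ^+ d by rewrite -exprD; congr (_ ^+ _); lia.
  have P0 : 0 <= r ^+ d.-1 * r ^+ d by rewrite mulr_ge0 // exprn_ge0 // ltW.
  move: (r ^+ d.-1) (r ^+ d) ((3 * a / 2) ^+ d) P0 DE => P Q q P0 DE.
  have -> : P * Q * r * (- 2 * (D - D0) * (2 * r)) + (d + d)%:R * (P * Q) * E -
      4 * (Q * q) * (d%:R * P) =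
      P * Q * (- 4 * r ^+ 2 * (D - D0) + 2 * d%:R * (E - 2 * q)) by rewrite natrD; ring.
  rewrite mulr_ge0_le0 // -a2.
  have r20 : 0 <= r ^+ 2 by exact: sqr_ge0.
  have := ler_wpM2l r20 DE; have := ler_wpM2l r20 D0le; lra.
- apply: continuous_subspaceT => r; apply: cvgB.
    apply: cvgM; first exact: exprn_continuous.
    apply: continuous_comp; [exact: exprn_continuous|exact: continuous_energy].
  by apply: cvgMr; exact: exprn_continuous.
Qed.

End slowed_heat_flow.

(** * Autocorrelation of the averaging process *)

Section autocorrelation.
Context {R : realType} {d N : nat}.
Hypothesis N2 : (2 < N)%N.
Local Notation T := (torus d N).
Implicit Types (p : pmf R T) (x v z : T).

Definition autocorr z p : R := \sum_x mass p x * mass p (x + z).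

Lemma mass_ge0 p x : 0 <= mass p x.
Proof. by have [/(_ x)] := set_mem (valP p). Qed.

Lemma sum_mass p : \sum_x mass p x = 1.
Proof. by have [_] := set_mem (valP p). Qed.

Lemma autocorr_ge0 z p : 0 <= autocorr z p.
Proof. by apply: sumr_ge0 => x _; rewrite mulr_ge0 ?mass_ge0. Qed.

Lemma sum_autocorr p : \sum_z autocorr z p = 1.
Proof.
rewrite exchange_big /=.
under eq_bigr => x _.
  rewrite -mulr_sumr; under eq_bigr do rewrite addrC.
  rewrite (sum_shift x (mass p)) sum_mass mulr1; over.
exact: sum_mass.
Qed.

Lemma autocorrN z p : autocorr (- z) p = autocorr z p.
Proof.
rewrite /autocorr -(sum_shift z (fun x => mass p x * mass p (x - z))).
by apply: eq_bigr => x _; rewrite addrK mulrC.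
Qed.

Lemma sum_mass_mass p z v : \sum_x mass p (x + z) * mass p (x + v) = autocorr (v - z) p.
Proof.
rewrite /autocorr -(sum_shift z (fun x => mass p x * mass p (x + (v - z)))).
by apply: eq_bigr => x _; rewrite -addrA [z + _]addrC subrK.
Qed.

(** Averaging adds a multiple of a difference of two unit masses, so quadratic functionals of the
    result can be expanded; the correction vanishes when [x = y]. *)
Lemma mass_averageE p x y a : mass (average p x y) a =
  mass p a + (mass p y - mass p x) / 2 * ((a == x)%:R - (a == y)%:R).
Proof.
rewrite [LHS]/(average_fun _ _ _ _) /average_fun -/(mass p x) -/(mass p y) -/(mass p a).
by case: eqVneq => [<-|_]; case: eqVneq => [<-|_] /=; field.
Qed.

(** Expands the autocorrelation of [p + g * D], where [D] is the unit mass at [x] minus that at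
    [x + v]: two cross terms, and the autocorrelation of [D]. *)
Lemma autocorr_average p x v z (g := (mass p (x + v) - mass p x) / 2) : v != 0 ->
  autocorr z (average p x (x + v)) - autocorr z p =
  g * ((mass p (x + z) - mass p (x + v + z)) + (mass p (x - z) - mass p (x + v - z)))
  + g ^+ 2 * (2 * (z == 0)%:R - (z == v)%:R - (z == - v)%:R).
Proof.
move=> v0; pose D a : R := (a == x)%:R - (a == x + v)%:R.
have sumD F : \sum_a D a * F a = F x - F (x + v).
  under eq_bigr do rewrite mulrBl.
  rewrite sumrB; congr (_ - _).
    by rewrite (bigD1 x) //= eqxx mul1r big1 ?addr0 // => a /negPf ->; rewrite mul0r.
  by rewrite (bigD1 (x + v)) //= eqxx mul1r big1 ?addr0 // => a /negPf ->; rewrite mul0r.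
transitivity (g * \sum_a D a * mass p (a + z) + g * \sum_a D a * mass p (a - z)
    + g ^+ 2 * \sum_a D a * D (a + z)).
  rewrite -[X in _ + g * X + _](sum_shift z) !mulr_sumr -!big_split -sumrB.
  by apply: eq_bigr => a _; rewrite !mass_averageE -/g -/(D a) -/(D (a + z)) addrK /=; ring.
rewrite !sumD -mulrDr; congr (_ + _ * _).
rewrite /D.
have e1 (a b : T) : (a + b == a) = (b == 0) by rewrite -subr_eq0 addrAC subrr add0r.
rewrite -[x + v + z]addrA !e1.
have -> : (x + z == x + v) = (z == v) by rewrite (inj_eq (addrI x)).
have -> : (x + (v + z) == x + v) = (z == 0) by rewrite (inj_eq (addrI x)) e1.
have -> : (v + z == 0) = (z == - v) by rewrite addrC addr_eq0.
ring.
Qed.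

(** The evolution closes because products of masses at a fixed displacement, summed over [x], are
    autocorrelations again. The cross terms yield the Laplacian; the terms in [g ^+ 2] sum to
    [(C 0 - C v) / 2] and yield the correction along the edges at 0. *)
Lemma averaging_generator_autocorr p z :
  averaging_generator (autocorr z) p =
  slowed_laplacian (E := @nbr d N) (autocorr ^~ p) z.
Proof.
pose C z := autocorr z p.
have step v : nbr v -> \sum_x (autocorr z (average p x (x + v)) - autocorr z p) =
    (C (z + v) + C (z - v) - 2 * C z) +
    2^-1 * ((C 0 - C v) * (2 * (z == 0)%:R - (z == v)%:R - (z == - v)%:R)).
  move=> nv; have v0 : v != 0 by apply: contraTneq nv => ->; exact: nbr0.
  under eq_bigr do rewrite autocorr_average //.
  rewrite big_split /= -mulr_suml; congr (_ + _).
    transitivity (\sum_x 2^-1 * (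
      mass p (x + v) * mass p (x + z) - mass p (x + v) * mass p (x + (v + z))
      + mass p (x + v) * mass p (x + (- z)) - mass p (x + v) * mass p (x + (v - z))
      - mass p (x + 0) * mass p (x + z) + mass p (x + 0) * mass p (x + (v + z))
      - mass p (x + 0) * mass p (x + (- z)) + mass p (x + 0) * mass p (x + (v - z)))).
      by apply: eq_bigr => x _; rewrite addr0 !addrA; field.
    rewrite -mulr_sumr !(big_split, sumrN) /= !sum_mass_mass.
    rewrite !subr0 [v + z]addrC addrK -[- z - v]opprD autocorrN.
    rewrite [v - z - v]addrAC subrr add0r -[v - z]opprB !autocorrN /C.
    by field.
  rewrite mulrA; congr (_ * _).
  transitivity (\sum_x 2^-1 * (2^-1 * (mass p (x + v) * mass p (x + v)
     + mass p (x + 0) * mass p (x + 0) - 2 * (mass p (x + 0) * mass p (x + v))))).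
    by apply: eq_bigr => x _; rewrite addr0; field.
  rewrite -!mulr_sumr !(big_split, sumrN) /= -!mulr_sumr !sum_mass_mass !subrr subr0 /C.
  by field.
rewrite /averaging_generator.
have -> : \sum_x \sum_(y | torus_dist x y == 1%N) (autocorr z (average p x y) - autocorr z p) =
    \sum_(v | nbr v) \sum_x (autocorr z (average p x (x + v)) - autocorr z p).
  rewrite exchange_big /=; apply: eq_bigr => x _.
  rewrite (reindex_inj (addrI x)); apply: eq_bigl => v /=.
  by rewrite torus_distE opprD addrA subrr add0r -/(nbr (- v)) nbrN.
rewrite (eq_bigr _ step) /slowed_laplacian /laplacian -/C.
rewrite big_split /= mulrDr; congr (_ + _).
  have -> : \sum_(v | nbr v) (C (z + v) + C (z - v) - 2 * C z) =
      \sum_(v | nbr v) (C (z + v) - C z) + \sum_(v | nbr v) (C (z - v) - C z).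
    by rewrite -big_split; apply: eq_bigr => v _ /=; ring.
  by rewrite (sum_nbrN (nbrN N2) (fun v => C (z + v) - C z)); field.
congr (_ * _); rewrite -mulr_sumr.
(* The autocorrelation is even, so the indicators of [v] and [- v] contribute equally. *)
have h : \sum_(v | nbr v) (C 0 - C v) * (z == - v)%:R =
    \sum_(v | nbr v) (C 0 - C v) * (z == v)%:R.
  rewrite -[RHS](sum_nbrN (nbrN N2)); apply: eq_bigr => v _.
  by rewrite /C autocorrN.
transitivity (2^-1 * (2 * \sum_(v | nbr v) (C 0 - C v) * (z == 0)%:R
    - \sum_(v | nbr v) (C 0 - C v) * (z == v)%:R
    - \sum_(v | nbr v) (C 0 - C v) * (z == - v)%:R)).
  congr (_ * _); rewrite mulr_sumr -!sumrB; apply: eq_bigr => v _; ring.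
rewrite h; under [RHS]eq_bigr do rewrite mulrBr.
by rewrite sumrB; field.
Qed.

Lemma continuous_mass x : continuous (fun p : pmf R T => mass p x).
Proof.
move=> p.
have h1 : {for p, continuous (fun q : pmf R T => set_val q : {ptws T -> R})}.
  exact: initial_continuous.
have h2 : {for (set_val p : {ptws T -> R}), continuous (fun q : {ptws T -> R} => q x : R)}.
  exact: (@proj_continuous T (fun=> R) x).
exact: (continuous_comp h1 h2).
Qed.

Lemma continuous_autocorr z : continuous (autocorr z).
Proof.
apply: continuous_sum_seq => x; apply: continuous_mul; first exact: continuous_mass.
exact: (continuous_mass (x + z)).
Qed.

End autocorrelation.

(** * Decay of the averaging process *)

Lemma measurable_fun_open (R : realType) (dO : measure_display) (Omega : measurableType dO)
    (g : Omega -> R) :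
  (forall U : set R, open U -> measurable (g @^-1` U)) -> measurable_fun setT g.
Proof.
move=> h; apply: (measurability _ (RGenOpens.measurableE R)) => //.
by move=> _ [_ [a [b ->]] <-]; rewrite setTI; apply: h; exact: interval_open.
Qed.

(** The Markov property from time 0 on the sure event, the start being almost surely [x0]. *)
Lemma markov_jump_expectation (R : realType) (K : topologicalType) (dO : measure_display)
    (Omega : measurableType dO) (P : probability Omega R) (L : (K -> R) -> K -> R)
    (S : R -> (K -> R) -> K -> R) (x0 : K) (X : R -> Omega -> K) (f : K -> R) (t : R) :
  markov_jump_process P L x0 X -> markov_semigroup S -> markov_property P S X ->
  0 <= t -> continuous f -> ('E_P[(fun w => f (X t w))] = (S t f x0)%:E)%E.
Proof.
move=> hX Ssemi SX t0 cf.
have cSf := semigroup_continuous Ssemi t0 cf.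
have hT : history X 0 setT by rewrite -setC0 -setTD; apply: sigma_algebraCD; exact: sigma_algebra0.
rewrite -(expectation_cst P) unlock.
have := SX 0 t f setT (lexx _) t0 cf hT; rewrite add0r => ->.
apply: ae_eq_integral => //.
- apply/measurable_EFinP; apply: measurable_fun_open => U oU.
  rewrite (_ : _ @^-1` U = X 0 @^-1` (S t f @^-1` U)) //.
  apply: (process_measurable hX) => //.
  by move/continuousP : cSf; apply.
- exact: (measurable_cst (S t f x0)%:E).
- by have := process_start hX; apply: filterS => w /= -> _.
Qed.

Section averaging.
Context {R : realType} {d N : nat}.
Hypothesis N2 : (2 < N)%N.
Local Notation T := (torus d N).
Local Notation n := (N%:R ^+ d : R).
Local Notation K := (pmf R T).

Let N_gt0 : 0 < N%:R :> R. Proof. by rewrite ltr0n; case: N N2. Qed.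
Let n_gt0 : 0 < n. Proof. exact: exprn_gt0. Qed.

(** The sum of the squared masses is the autocorrelation at displacement 0. *)
Lemma l2norm_deviation (p : K) :
  l2norm (@uniform_mass R d N) (fun x => mass p x / uniform_mass x - 1) ^+ 2 =
  n * autocorr 0 p - 1.
Proof.
rewrite /l2norm sqr_sqrtr; last first.
  apply: sumr_ge0 => x _; rewrite mulr_ge0 ?sqr_ge0 // /uniform_mass invr_ge0.
  exact: ltW.
transitivity (\sum_x (n * (mass p x * mass p (x + 0)) - 2 * mass p x + n^-1)).
  apply: eq_bigr => x _; rewrite /uniform_mass invrK real_normK ?num_real // addr0.
  by field; rewrite gt_eqF.
rewrite big_split sumrB /= -!mulr_sumr sum_mass (sum_uniform N2) /autocorr; ring.
Qed.

Lemma autocorr_dirac (z : T) : autocorr (R := R) z (dirac_mass 0) = (z == 0)%:R.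
Proof.
have massE (x : T) : mass (R := R) (dirac_mass 0) x = (x == 0)%:R by [].
rewrite /autocorr (bigD1 0) //= big1 ?addr0 => [|x /negPf x0].
  by rewrite !massE eqxx mul1r add0r.
by rewrite massE x0 mul0r.
Qed.

Section flow.
Context (S : R -> (K -> R) -> K -> R).
Hypotheses (Ssemi : markov_semigroup S) (SL : has_generator S (@averaging_generator R d N)).

(** The expected autocorrelation, frozen at its initial value for negative times. *)
Definition corr_flow (z : T) : R -> R := orbit S (autocorr z) (dirac_mass 0).

Lemma continuous_slowed_autocorr (z : T) :
  continuous (fun p : K => slowed_laplacian (E := @nbr d N) (autocorr^~ p) z).
Proof.
have cB y y' : continuous (fun p : K => autocorr y p - autocorr y' p).
  by apply: continuous_sub; exact: continuous_autocorr.
apply: continuous_add; first by apply: continuous_sum_seq => v; exact: cB.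
apply: continuous_mul; first exact: cst_continuous.
apply: continuous_sum_seq => v; apply: continuous_mul; first exact: cB.
exact: cst_continuous.
Qed.

(** The generator sends [autocorr z] to a finite linear combination of autocorrelations, through
    which the linear semigroup passes. *)
Lemma is_derive_corr_flow (z : T) (t : R) : 0 < t ->
  is_derive t 1 (corr_flow z) (slowed_laplacian (E := @nbr d N) (corr_flow^~ t) z).
Proof.
move=> t0.
have gen : averaging_generator (autocorr z) =
    (fun p : K => slowed_laplacian (E := @nbr d N) (autocorr^~ p) z).
  by apply/funext => p; exact: averaging_generator_autocorr.
have cg : continuous (averaging_generator (R := R) (autocorr z)).
  by rewrite gen; exact: continuous_slowed_autocorr.
apply: is_derive_eq
  (is_derive_orbit S _ Ssemi SL _ t (dirac_mass 0) (continuous_autocorr z) cg t0) _.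
have m0 : 0 <= Num.max t 0 by rewrite le_max lexx orbT.
have cA y : continuous (fun p : K => autocorr (R := R) y p) by exact: continuous_autocorr.
have cB y y' : continuous (fun p : K => autocorr y p - autocorr y' p).
  exact: continuous_sub.
have cBc y y' (c : R) : continuous (fun p : K => c * (autocorr y p - autocorr y' p)).
  by apply: continuous_mul; [exact: cst_continuous|exact: cB].
rewrite /orbit gen /slowed_laplacian /laplacian /corr_flow /orbit; set m := Num.max t 0.
pose c v : R := (z == 0)%:R - (z == v)%:R.
pose G (p : K) : R := \sum_(v | nbr v) c v * (autocorr 0 p - autocorr v p).
pose H (p : K) : R := \sum_(v | nbr v) (autocorr (z + v) p - autocorr z p).
transitivity (S m (fun p => 2^-1 * G p + H p) (dirac_mass 0)).
  congr (S m _ _); apply/funext => p; rewrite addrC; congr (_ * _ + _).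
  by apply: eq_bigr => v _; rewrite mulrC.
have cG : continuous G by apply: continuous_sum_seq => v; exact: cBc.
have cH : continuous H by apply: continuous_sum_seq => v; exact: cB.
rewrite (semigroup_linear Ssemi) //.
rewrite (semigroup_sum S Ssemi _ _ _ _ _ _ m0 (fun v => cBc 0 v (c v))).
rewrite (semigroup_sum S Ssemi _ _ _ _ _ _ m0 (fun v => cB (z + v) z)).
rewrite addrC; congr (_ + _ * _).
  by apply: eq_bigr => v _; rewrite (semigroup_sub S Ssemi _ _ _ _ m0 (cA _) (cA _)).
apply: eq_bigr => v _; rewrite (semigroup_scale S Ssemi _ _ _ _ m0 (cB _ _)).
by rewrite (semigroup_sub S Ssemi _ _ _ _ m0 (cA _) (cA _)) mulrC.
Qed.

Lemma corr_flow0 (z : T) : corr_flow z 0 = (z == 0)%:R.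
Proof.
rewrite /corr_flow /orbit maxxx (semigroup_0 Ssemi) ?autocorr_dirac //.
exact: continuous_autocorr.
Qed.

Lemma corr_flow_ge0 (z : T) (t : R) : 0 <= t -> 0 <= corr_flow z t.
Proof.
move=> t0; rewrite /corr_flow /orbit max_l //.
by apply: (semigroup_ge0 Ssemi) => //; [exact: continuous_autocorr|exact: autocorr_ge0].
Qed.

Lemma sum_corr_flow (t : R) : 0 <= t -> \sum_z corr_flow z t = 1.
Proof.
move=> t0; rewrite /corr_flow /orbit max_l //.
rewrite -(semigroup_sum S Ssemi) //; last exact: continuous_autocorr.
rewrite -[RHS](semigroup_cst1 Ssemi t0 (dirac_mass 0)); congr (S t _ _).
by apply/funext => p; exact: sum_autocorr.
Qed.

End flow.

End averaging.

(** * Combination of the polynomial and exponential decays *)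

Section decay.
Context {R : realType} {d N : nat}.
Hypotheses (d1 : (1 <= d)%N) (N2 : (2 < N)%N).
Local Notation T := (torus d N).
Local Notation n := (N%:R ^+ d : R).
Local Notation gap := (1 - cos (2 * pi / N%:R) : R).
Local Notation defect := (gap_defect (R := R) (d := d) / N%:R ^+ (d + 2)).

Let N_gt0 : 0 < N%:R :> R. Proof. by rewrite ltr0n; case: N N2. Qed.
Let n_gt0 : 0 < n. Proof. exact: exprn_gt0. Qed.

(** The first factor covers both the trivial bound by 1 and Nash's bound; the exponential pays for
    starting the exponential decay late. *)
Definition bound_cst : R := (1 + nash_cst (d := d) * 2 ^+ d) * expR (4 * pi ^+ 2).

Lemma nash_cst_ge0 : 0 <= nash_cst (R := R) (d := d).
Proof. by rewrite /nash_cst mulr_ge0 // exprn_ge0 // divr_ge0 // mulr_ge0 ?sqrtr_ge0. Qed.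

(** Here [y] stands for the energy; it is taken at [t / 2] because it represents the autocorrelation
    at twice its time. *)
Lemma decay_bound (y : R -> R) (t : R) : 0 <= t ->
  (forall r, 0 <= r -> 0 <= y r) -> (forall r, 0 <= r -> y r <= 1) ->
  (forall r, 0 <= r -> r ^+ d * y (r ^+ 2) <= nash_cst (d := d)) ->
  (forall r s, 0 <= r <= s ->
     y s <= y r * expR (- (2 * (2 * gap - defect) * (s - r)))) ->
  n * y (t / 2) <= bound_cst * n / Num.max (Num.min n (t `^ (d%:R / 2))) 1 *
     expR (- (2 * t / relaxation_time N) + gap_defect (d := d) * t / N%:R ^+ (d + 2)).
Proof.
move=> t0 y0 y1 ypoly yexp.
set M := Num.max _ 1; have M0 : 0 < M by rewrite lt_max ltr01 orbT.
rewrite [bound_cst * n]mulrC -2![leRHS]mulrA ler_pM2l //.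
rewrite mulrA.
pose s := Num.min t (N%:R ^+ 2).
have s0 : 0 <= s by rewrite le_min t0 sqr_ge0.
have st : s <= t by rewrite ge_min lexx.
have sN : s <= N%:R ^+ 2 by rewrite ge_min lexx orbT.
have tE : t `^ (d%:R / 2) = Num.sqrt t ^+ d.
  by rewrite mulrC powRrM powR12_sqrt // powR_mulrn ?sqrtr_ge0.
(* If [M = 1], the bound by 1 suffices. Otherwise [M <= sqrt s ^ d], and [2 ^+ d] absorbs the
   passage from [s] to [s / 2]. *)
have Ms : y (s / 2) * M <= 1 + nash_cst (d := d) * 2 ^+ d.
  have ys0 : 0 <= y (s / 2) by apply: y0; rewrite divr_ge0.
  have ys1 : y (s / 2) <= 1 by apply: y1; rewrite divr_ge0.
  have K0 : 0 <= nash_cst (R := R) (d := d) * 2 ^+ d by rewrite mulr_ge0 ?nash_cst_ge0 ?exprn_ge0.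
  rewrite /M /Num.max; case: ifP => _; first by rewrite mulr1; lra.
  have Mle : Num.min n (t `^ (d%:R / 2)) <= Num.sqrt s ^+ d.
    rewrite tE /s; case: (leP t (N%:R ^+ 2)) => _; first by rewrite ge_min lexx orbT.
    by rewrite sqrtr_sqr ger0_norm ?ge_min ?lexx // ltW.
  have := ypoly (Num.sqrt (s / 2)) (sqrtr_ge0 _); rewrite sqr_sqrtr ?divr_ge0 // => h.
  have sq : Num.sqrt s <= 2 * Num.sqrt (s / 2).
    rewrite -(@ler_pXn2r _ 2) ?nnegrE ?mulr_ge0 ?sqrtr_ge0 //.
    by rewrite exprMn !sqr_sqrtr ?divr_ge0 //; lra.
  apply: (le_trans (ler_wpM2l ys0 Mle)).
  apply: (@le_trans _ _ (y (s / 2) * (2 * Num.sqrt (s / 2)) ^+ d)).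
    by rewrite ler_wpM2l // lerXn2r ?nnegrE ?mulr_ge0 ?sqrtr_ge0.
  have := ler_wpM2r (exprn_ge0 d (ler0n R 2)) h.
  by rewrite exprMn; move: (_ ^+ d) (2 ^+ d) K0 => p q; lra.
(* The time before [s / 2] forfeits [2 * gap * s], at most [4 * pi ^+ 2] since
   [gap <= 2 * pi ^+ 2 / N ^ 2] and [s <= N ^ 2]. The term [defect * s] has the favourable sign. *)
have ex : - (2 * (2 * gap - defect) * (t / 2 - s / 2)) <=
    4 * pi ^+ 2 + (- (2 * t / relaxation_time N) + gap_defect (d := d) * t / N%:R ^+ (d + 2)).
  have -> : 2 * t / relaxation_time N = 2 * gap * t.
    by rewrite /relaxation_time div1r invrK; ring.
  have := gap_le (R := R) N2; have := gap_ge0 (R := R) (N := N).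
  set g := gap => g0 g1.
  have gs : g * s <= 2 * pi ^+ 2.
    apply: (@le_trans _ _ (g * N%:R ^+ 2)); first by rewrite ler_wpM2l.
    by rewrite -ler_pdivlMr // exprn_gt0.
  have D0 : 0 <= defect * s.
    by rewrite mulr_ge0 // /gap_defect divr_ge0 ?mulr_ge0 ?exprn_ge0 ?mulr_ge0 ?pi_ge0 ?(ltW N_gt0).
  rewrite [gap_defect * t / _]mulrAC; move: (gap_defect / _) D0 => D D0; lra.
apply: (le_trans (yexp (s / 2) (t / 2) _)); first by lra.
rewrite /bound_cst [_ / M * _]mulrAC ler_pdivlMr // mulrAC -[leRHS]mulrA -expRD.
by apply: ler_pM => //; rewrite ?ler_expR ?expR_ge0 // mulr_ge0 ?(ltW M0) // y0 // divr_ge0.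
Qed.

End decay.

Theorem corollary2p3 (R : realType) (d : nat) (hd : (1 <= d)%N) :
  exists B C : R, 0 < B /\ 0 < C /\
  exists N0 : nat, forall N : nat, (N0 <= N)%N ->
  forall (dO : measure_display) (Omega : measurableType dO)
    (P : probability Omega R) (eta : R -> Omega -> pmf R (torus d N)),
  averaging_process P (dirac_mass (0 : torus d N)) eta ->
  forall t : R, 0 <= t ->
  ('E_P[(fun w => l2norm (@uniform_mass R d N)
                   (fun x => mass (eta t w) x / uniform_mass x - 1) ^+ 2)%R]
   <= (C * N%:R ^+ d
         / Num.max (Num.min (N%:R ^+ d) (t `^ (d%:R / 2))) 1
       * expR (- (2 * t / relaxation_time N) + B * t / N%:R ^+ (d + 2)))%:E)%E.
Proof.
exists (gap_defect (d := d)), (bound_cst (d := d)); split.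
  by rewrite /gap_defect !mulr_gt0 ?exprn_gt0 ?mulr_gt0 ?pi_gt0.
split.
  rewrite /bound_cst mulr_gt0 ?expR_gt0 // ltr_wpDr // mulr_ge0 ?exprn_ge0 //.
  exact: nash_cst_ge0.
(* From [N = 3] on, the two neighbours of 0 along a coordinate axis are distinct. *)
exists 3%N => N N2 dO Omega P eta heta t t0.
have [S [Ssemi SL SX]] := process_markov heta.
pose f (p : pmf R (torus d N)) : R := N%:R ^+ d * autocorr 0 p - 1.
have cA : continuous (fun p : pmf R (torus d N) => autocorr (R := R) 0 p).
  exact: continuous_autocorr.
have cnA : continuous (fun p : pmf R (torus d N) => N%:R ^+ d * autocorr 0 p : R).
  by apply: continuous_mul => //; exact: cst_continuous.
have cf : continuous f by apply: continuous_sub => //; exact: cst_continuous.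
rewrite (_ : (fun w => _) = (fun w => f (eta t w))); last first.
  by apply/funext => w; exact: l2norm_deviation.
rewrite (markov_jump_expectation _ _ _ _ _ _ S _ _ _ _ heta Ssemi SX t0 cf) lee_fin.
pose u := corr_flow (d := d) (N := N) S.
have u_cont z : continuous (u z).
  by apply: continuous_orbit => //; exact: continuous_autocorr.
have u_der z (r : R) := is_derive_corr_flow N2 S Ssemi SL z r.
have u_0 := corr_flow0 S Ssemi.
have u_ge0 := corr_flow_ge0 S Ssemi.
have u_sum := sum_corr_flow S Ssemi.
(* [energyE] doubles the time, so the value at [t] is read off the energy at [t / 2]. *)
have -> : S t f (dirac_mass 0) = N%:R ^+ d * energy u (t / 2).
  have t2 : 0 <= t / 2 by rewrite divr_ge0.
  rewrite (energyE N2 u) // mulrBr divff ?expf_neq0 ?pnatr_eq0 -?lt0n ?(ltn_trans _ N2) //.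
  rewrite -splitr /u /corr_flow /orbit max_l // /f.
  rewrite (semigroup_sub S Ssemi) //; last exact: cst_continuous.
  by rewrite (semigroup_scale S Ssemi) // (semigroup_cst S Ssemi).
apply: (decay_bound N2 (energy u)) => //.
- by move=> r _; exact: energy_ge0.
- by move=> r r0; apply: energy_le1.
- by move=> r r0; apply: energy_poly_decay.
- by move=> r s rs; apply: energy_exp_decay.
Qed.
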